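(* Let $0\le i,j\le n-1$ and $0\le e,f\le d-1$ be integers, and let $V=V(i,e)\otimes V(j,f)$ in $\mathcal{C}(n,s,q)$. If $e+f\le d-1$, then $$V\cong\begin{cases}\bigoplus_{k=0}^{e}V(i+j+k,\,e+f-2k), & \text{if } e\le f,\\[2pt] \bigoplus_{k=0}^{f}V(i+j+k,\,e+f-2k), & \text{otherwise.}\end{cases}$$ If $e+f\ge d$, set $\gamma=e+f-d+1$; then $$V\cong\begin{cases}\bigoplus_{k=0}^{\gamma}V(i+j+k,\,d-1)\ \oplus\ \bigoplus_{l=\gamma+1}^{e}V(i+j+l,\,e+f-2l), & \text{if } e\le f,\\[2pt] \bigoplus_{k=0}^{\gamma}V(i+j+k,\,d-1)\ \oplus\ \bigoplus_{l=\gamma+1}^{f}V(i+j+l,\,e+f-2l), & \text{otherwise.}\end{cases}$$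
   Context: Throughout, $k$ is an algebraically closed field of characteristic $0$, $n>1$ is an integer, $\zeta\in k$ is a fixed primitive $n$-th root of unity, $s$ is an integer with $0\le s\le n-1$, $q\in k$ satisfies $q^n=\zeta^s$, and $d$ is the multiplicative order of $q$. For an integer $m$, $m'$ denotes the remainder of $m$ on division by $n$. Let $Z_n$ be the cyclic quiver with vertices $g^i$ ($i\in\mathbb{Z}/n$) and arrows $a_i:g^i\to g^{i+1}$, and let $p_i^l=a_{i+l-1}\cdots a_{i+1}a_i$ be the path of length $l$ starting at $g^i$ (with $p_i^0=g^i$). For $\hbar\in k$ put $m_\hbar=1+\hbar+\cdots+\hbar^{m-1}$, $m!_\hbar=1_\hbar\cdots m_\hbar$, and let $\binom{l+m}{l}_\hbar$ be the Gaussian binomial coefficient $\frac{(l+m)!_\hbar}{l!_\hbar m!_\hbar}$ (the value at $\hbar$ of the corresponding polynomial). $M(n,s,q)$ is the graded coquasi-Hopf algebra with $k$-basis $\{p_i^l: 0\le i\le n-1,\ 0\le l\le d-1\}$, coproduct $\Delta(p_i^l)=\sum_{m=0}^l p_{(i+m)'}^{l-m}\otimes p_i^m$, counit $\varepsilon(p_i^l)=\delta_{l,0}$, and multiplication $$p_i^l\cdot p_j^m=\zeta^{-sjl}\,q^{-jl}\,\zeta^{\frac{s(i+l')[m+j-(m+j)']}{n}}\binom{l+m}{l}_{\zeta^{-s}q^{-1}}p_{(i+j)'}^{l+m}$$ (the coefficient vanishes when $l+m\ge d$). The category $\mathcal{C}(n,s,q)$ is the tensor category of finite-dimensional right $M(n,s,q)$-comodules;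 the coaction on $U\otimes W$ is $u\otimes w\mapsto \sum u_{(0)}\otimes w_{(0)}\otimes u_{(1)}w_{(1)}$. (The multiplication of $M(n,s,q)$ is associative only up to an associator; the associativity constraint affects only identifications of iterated tensor products, which are determined up to isomorphism.) For $0\le i\le n-1$, $0\le e\le d-1$, $V(i,e)$ is the comodule with basis $v_0^i,\dots,v_e^i$ and coaction $\delta(v_m^i)=\sum_{x=m}^e v_x^i\otimes p_{(i+m)'}^{x-m}$. These form a complete list, without repetition, of the indecomposable objects of $\mathcal{C}(n,s,q)$ up to isomorphism. For an integer $i\ge n$, $V(i,e)$ means $V(i',e)$. An empty direct sum is $0$. *)

(* Defs.v *)
From HB Require Import structures.
From mathcomp Require Import all_boot all_order all_algebra.
From mathcomp Require Import ring zify.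

Set Implicit Arguments.
Unset Strict Implicit.
Unset Printing Implicit Defensive.

Import GRing.Theory.
Local Open Scope ring_scope.

Section Gauss.
Variable R : fieldType.
Implicit Types (h : R).

Definition qint (m : nat) : {poly R} := \sum_(i < m) 'X^i.
Definition qfact (m : nat) : {poly R} := \prod_(i < m) qint i.+1.

(* [gauss l m h] is the coefficient ((l+m) choose l)_h.  The quotient is taken
   in {poly R}, where it is exact (see [gauss_qfact]), and then evaluated. *)
Definition gauss (l m : nat) h : R :=
  (qfact (l + m) %/ (qfact l * qfact m)).[h].

Fixpoint qbin (S : comNzRingType) (x : S) (N l : nat) : S :=
  match N, l with
  | _, 0%N => 1
  | 0%N, _.+1 => 0
  | N'.+1, l'.+1 => qbin x N' l' + x ^+ l'.+1 * qbin x N' l'.+1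
  end.

Lemma qbinN0 (S : comNzRingType) (x : S) N : qbin x N 0 = 1.
Proof. by case: N. Qed.

Lemma qbin_small (S : comNzRingType) (x : S) N l : (N < l)%N -> qbin x N l = 0.
Proof.
elim: N l => [|N IH] [|l] //= lt_Nl.
by rewrite !IH ?mulr0 ?addr0 //; lia.
Qed.

Lemma qbinnn (S : comNzRingType) (x : S) N : qbin x N N = 1.
Proof. by elim: N => //= N ->; rewrite qbin_small ?mulr0 ?addr0. Qed.

Lemma qintD l m : qint (l + m) = qint l + 'X^l * qint m.
Proof.
rewrite /qint big_split_ord /= mulr_sumr; congr (_ + _).
by apply: eq_bigr => i _; rewrite exprD.
Qed.

Lemma qfactS m : qfact m.+1 = qfact m * qint m.+1.
Proof. by rewrite /qfact big_ord_recr. Qed.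

Lemma size_qint m : size (qint m) = m.
Proof.
rewrite /qint (_ : \sum_(i < m) _ = \poly_(i < m) 1); last first.
  by rewrite poly_def; apply: eq_bigr => i _; rewrite scale1r.
by case: m => [|m]; [rewrite poly_def big_ord0 size_poly0 | rewrite size_poly_eq ?oner_neq0].
Qed.

Lemma qint_neq0 m : qint m.+1 != 0.
Proof. by rewrite -size_poly_eq0 size_qint. Qed.

Lemma qfact_neq0 m : qfact m != 0.
Proof. by apply/prodf_neq0 => i _; apply: qint_neq0. Qed.

Lemma qfact0 : qfact 0 = 1. Proof. by rewrite /qfact big_ord0. Qed.

Lemma qbin_qfact l m :
  qfact (l + m) = qbin ('X : {poly R}) (l + m) l * (qfact l * qfact m).
Proof.
have [N defN] : {N | N = l + m}%N by exists (l + m)%N.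
rewrite -defN; elim: N l m defN => [|N IH] [|l] [|m] //= defN.
- by rewrite qfact0 !mulr1.
- by rewrite qfact0 !mul1r defN.
- have -> : N = l by lia.
  by rewrite qbinnn qbin_small // mulr0 addr0 qfact0 mulr1 mul1r.
have E1 := IH l m.+1 ltac:(lia); have E2 := IH l.+1 m ltac:(lia).
have -> : qfact N.+1 = qfact N * (qint l.+1 + 'X^(l.+1) * qint m.+1).
  by rewrite qfactS defN qintD.
by rewrite mulrDr {1}E1 {1}E2 !qfactS; ring.
Qed.

Lemma gauss_qfact l m :
  qfact (l + m) = (qfact (l + m) %/ (qfact l * qfact m)) * (qfact l * qfact m).
Proof.
by rewrite {2}qbin_qfact mulpK ?mulf_neq0 ?qfact_neq0 // -qbin_qfact.
Qed.

Lemma gaussE l m h : gauss l m h = qbin h (l + m) l.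
Proof.
rewrite /gauss qbin_qfact mulpK ?mulf_neq0 ?qfact_neq0 //.
move: (l + m)%N => N; elim: N l => [|N IH] [|l] //=; rewrite ?hornerC //.
by rewrite hornerD hornerM hornerXn !IH.
Qed.

Lemma gauss_recr l m h :
  gauss l.+1 m.+1 h = h ^+ m.+1 * gauss l m.+1 h + gauss l.+1 m h.
Proof.
rewrite -[X in X * _ + _]hornerXn /gauss -hornerM -hornerD; congr _.[h].
have nz a b : qfact a * qfact b != 0 by rewrite mulf_neq0 ?qfact_neq0.
apply: (mulIf (nz l.+1 m.+1)); rewrite -gauss_qfact.
have := gauss_qfact l m.+1; have := gauss_qfact l.+1 m.
rewrite !addnS !addSn; set P := _ %/ _; set Q := _ %/ _ => E2 E1.
have -> : qfact (l + m).+2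
    = qfact (l + m).+1 * (qint m.+1 + 'X^(m.+1) * qint l.+1).
  by rewrite qfactS -qintD; congr (_ * qint _); lia.
by rewrite mulrDr {1}E2 E1 !qfactS; ring.
Qed.

Lemma qbinSr N l h : (l <= N)%N ->
  qbin h N.+1 l.+1 = h ^+ (N - l) * qbin h N l + qbin h N l.+1.
Proof.
rewrite leq_eqVlt => /predU1P[->|lt_lN].
  by rewrite qbinnn subnn [X in _ + X]qbin_small // addr0 mul1r qbinnn.
have [m defN] : {m | N = l + m.+1}%N by exists (N - l.+1)%N; lia.
have := gauss_recr l m h; rewrite !gaussE defN.
have -> : (l + m.+1 - l = m.+1)%N by lia.
by rewrite !addnS !addSn.
Qed.

Lemma qbin_vandermonde M r l h :
  qbin h (M + r) l =
  \sum_(a < l.+1) h ^+ ((r - a) * (l - a)) * qbin h M (l - a) * qbin h r a.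
Proof.
elim: r M l => [|r IH] M l.
  rewrite addn0 big_ord_recl big1 => [|i _]; last by rewrite /= mulr0.
  by rewrite !subn0 mul0n mul1r qbinN0 mulr1 addr0.
rewrite addnS -addSn IH.
case: l => [|l].
  by rewrite !big_ord_recl !big_ord0 !addr0 muln0 !qbinN0 ?muln0.
pose A a := h ^+ ((r.+1 - a) * (l.+1 - a)) * qbin h M (l.+1 - a) * qbin h r a.
pose B a := h ^+ ((r - a) * (l.+1 - a)) * qbin h M (l - a) * qbin h r a.
transitivity (\sum_(a < l.+2) A a + \sum_(a < l.+1) B a).
  rewrite big_ord_recr [in RHS]big_ord_recr /= -addrA [_ + \sum_(a < _) B _]addrC.
  rewrite addrA -big_split /=; congr (_ + _); last first.
    by rewrite /A subnn !muln0 !qbinN0.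
  apply: eq_bigr => -[a /= lt_al] _; rewrite /A /B.
  have [lt_ra|le_ar] := ltnP r a; first by rewrite !(qbin_small _ lt_ra) !mulr0 addr0.
  by rewrite !subSn //= mulSn !mulnS !exprD; ring.
rewrite big_ord_recl [in RHS]big_ord_recl -addrA; congr (_ + _).
  by rewrite /A !subn0 !qbinN0.
rewrite -big_split; apply: eq_bigr => -[a /= lt_al] _.
rewrite /A /B /bump /= !add1n !subSS.
have [le_ar|lt_ra] := leqP a r; last first.
  by rewrite !(@qbin_small _ h r) ?mulr0 ?addr0 ?mulr0 //; lia.
rewrite -[qbin h r a + _]/(qbin h r.+1 a.+1) qbinSr // subSn // mulnS exprD.
by ring.
Qed.

End Gauss.

(* The basis of M(n,s,q) is indexed by 'I_n * 'I_d, with (i, l) standing for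
   p_i^l.  An element of M(n,s,q) is its family of coordinates, of type
   {ffun 'I_n * 'I_d -> K}; likewise an element of M(n,s,q) (x) M(n,s,q), or of
   V (x) M(n,s,q) for a vector space V, where the coordinates lie in V.

   [qpath i l] is p_(i')^l when l < d, and 0 when d <= l.  [coprod], [counit] and
   [mulM] are the values of the structure maps on basis elements.  The associator
   and the antipode of M(n,s,q) do not occur: they play no part in comodules, in
   their isomorphisms, or in the tensor product of two of them. *)
Section CoquasiHopf.
Variables (K : fieldType) (n s d : nat) (zeta q : K).
Local Notation B := ('I_n * 'I_d)%type.

Definition qpath (i l : nat) : {ffun B -> K} :=
  [ffun b : B => ((b.1 == (i %% n)%N :> nat) && (b.2 == l :> nat))%:R].

Definition coprod (b : B) : {ffun B * B -> K} :=
  \sum_(m < b.2.+1)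
    [ffun c : B * B => qpath (b.1 + m) (b.2 - m) c.1 * qpath b.1 m c.2].

Definition counit (b : B) : K := (b.2 == 0 :> nat)%:R.

Definition mcoef (i l j m : nat) : K :=
  zeta ^- (s * j * l) * q ^- (j * l)
  * zeta ^+ ((s * (i + l %% n) * (m + j - (m + j) %% n)) %/ n)
  * gauss l m (zeta ^- s * q^-1).

Definition mulM (b c : B) : {ffun B -> K} :=
  [ffun x : B => mcoef b.1 b.2 c.1 c.2 * qpath (b.1 + c.1) (b.2 + c.2) x].

(* d is the multiplicative order of q. *)
Record admissible : Prop := Admissible {
  adm_n : (1 < n)%N;
  adm_zeta : n.-primitive_root zeta;
  adm_s : (s < n)%N;
  adm_q : q ^+ n = zeta ^+ s;
  adm_d : d.-primitive_root q
}.

Hypothesis H : admissible.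
Local Notation hbar := (zeta ^- s * q^-1).

Let n_gt0 : (0 < n)%N. Proof. exact: ltnW (adm_n H). Qed.
Let d_gt0 : (0 < d)%N. Proof. exact: prim_order_gt0 (adm_d H). Qed.

Lemma qpath_mod i l : qpath (i %% n) l = qpath i l.
Proof. by rewrite /qpath modn_mod. Qed.

Lemma qpath_eqmod i j l : i = j %[mod n] -> qpath i l = qpath j l.
Proof. by rewrite /qpath => ->. Qed.

Lemma qpath_ge i l : (d <= l)%N -> qpath i l = 0.
Proof.
move=> le_dl; apply/ffunP => b; rewrite !ffunE.
by have := ltn_ord b.2; case: eqP => //= _; case: eqP => // ->; lia.
Qed.

Lemma sum_qpath (V : lmodType K) (F : nat -> nat -> V) i l : (l < d)%N ->
  \sum_(b : B) qpath i l b *: F b.1 b.2 = F (i %% n)%N l.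
Proof.
move=> lt_ld; have lt_in : (i %% n < n)%N by rewrite ltn_mod.
rewrite (bigD1 (Ordinal lt_in, Ordinal lt_ld)) //= ffunE !eqxx scale1r.
rewrite big1 ?addr0 // => -[b1 b2]; rewrite ffunE xpair_eqE -!val_eqE /=.
by move/negbTE->; rewrite scale0r.
Qed.

Lemma sum_coprod (V : lmodType K) (F : nat -> nat -> nat -> nat -> V) (b : B) :
  \sum_(c : B * B) coprod b c *: F c.1.1 c.1.2 c.2.1 c.2.2
  = \sum_(m < b.2.+1) F ((b.1 + m) %% n)%N (b.2 - m)%N b.1 m.
Proof.
under eq_bigr => c _ do rewrite sum_ffunE scaler_suml.
rewrite exchange_big; apply: eq_bigr => m _ /=.
have lt_bd := ltn_ord b.2; have lt_mb := ltn_ord m.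
transitivity (\sum_(x : B) qpath (b.1 + m) (b.2 - m) x *:
    \sum_(y : B) qpath b.1 m y *: F x.1 x.2 y.1 y.2).
  under [RHS]eq_bigr => x _ do rewrite scaler_sumr.
  rewrite pair_big; apply: eq_bigr => c _ /=.
  by rewrite ffunE scalerA.
have lt1 : (b.2 - m < d)%N by lia.
have lt2 : (m < d)%N by lia.
rewrite (sum_qpath (fun x1 x2 => \sum_(y : B) qpath b.1 m y *: F x1 x2 y.1 y.2)) //.
by rewrite (sum_qpath (F _ _)) // [(b.1 %% n)%N]modn_small.
Qed.

Let q_neq0 : q != 0.
Proof.
by have := prim_expr_order (adm_d H); apply: contra_eqN => /eqP->;
   rewrite expr0n gtn_eqF // eq_sym oner_eq0.
Qed.

Let z_neq0 : zeta ^+ s != 0. Proof. by rewrite -(adm_q H) expf_neq0. Qed.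

Let z_n : (zeta ^+ s) ^+ n = 1.
Proof. by rewrite exprAC (prim_expr_order (adm_zeta H)) expr1n. Qed.

Lemma hbarE : hbar = q ^- n.+1.
Proof. by rewrite -(adm_q H) -invfM -exprSr. Qed.

Lemma hbar_n : hbar ^+ n = zeta ^- s.
Proof. by rewrite exprMn exprVn z_n invr1 mul1r exprVn (adm_q H). Qed.

Lemma hbar_order k : (d %| k)%N = (hbar ^+ k == 1).
Proof.
have co : coprime d n.+1.
  have dvd_d : (d %| n * n)%N.
    by rewrite (prim_order_dvd (adm_d H)) exprM (adm_q H) z_n.
  by apply: (coprime_dvdl dvd_d); rewrite coprimeMl coprimenS.
rewrite hbarE exprVn -exprM invr_eq1 -(prim_order_dvd (adm_d H)).
by rewrite Gauss_dvdr.
Qed.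

Lemma gauss_ge l m : (l < d)%N -> (m < d)%N -> (d <= l + m)%N ->
  gauss l m hbar = 0.
Proof.
move=> lt_ld lt_md le_d.
have geo k : (hbar - 1) * (qint K k).[hbar] = hbar ^+ k - 1.
  rewrite subrX1 /qint horner_sum; congr (_ * _).
  by apply: eq_bigr => i _; rewrite hornerXn.
have d_gt1 : (1 < d)%N by lia.
have hbar1 : hbar - 1 != 0.
  have := hbar_order 1; rewrite expr1 subr_eq0 => <-.
  by rewrite dvdn1 gtn_eqF.
have fact_neq0 k : (k < d)%N -> (qfact K k).[hbar] != 0.
  move=> lt_kd; rewrite /qfact horner_prod; apply/prodf_neq0 => -[i lt_ik] _ /=.
  suff: (hbar - 1) * (qint K i.+1).[hbar] != 0 by rewrite mulf_eq0 negb_or => /andP[].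
  rewrite geo subr_eq0 -hbar_order gtnNdvd //; lia.
have fact0 : (qfact K (l + m)).[hbar] = 0.
  have lt_d : (d.-1 < l + m)%N by lia.
  rewrite /qfact horner_prod (bigD1 (Ordinal lt_d)) //= prednK //.
  suff -> : (qint K d).[hbar] = 0 by rewrite mul0r.
  by apply: (mulfI hbar1); rewrite geo mulr0; apply/eqP; rewrite subr_eq0 -hbar_order.
move: fact0; rewrite gauss_qfact !hornerM => /eqP.
by rewrite !mulf_eq0 (negbTE (fact_neq0 _ lt_ld)) (negbTE (fact_neq0 _ lt_md)) !orbF => /eqP.
Qed.

Lemma mcoef_ge i l j m : (l < d)%N -> (m < d)%N -> (d <= l + m)%N ->
  mcoef i l j m = 0.
Proof. by move=> *; rewrite /mcoef gauss_ge ?mulr0. Qed.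

Let zmod a b : a = b %[mod n] -> (zeta ^+ s) ^+ a = (zeta ^+ s) ^+ b.
Proof. by move=> eq_ab; rewrite -(expr_mod a z_n) eq_ab expr_mod. Qed.

Let twist i l j m : K :=
  hbar ^+ (j * l) * (zeta ^+ s) ^+ ((i + l) * ((m + j) %/ n)).

Let mcoefE i l j m : mcoef i l j m = twist i l j m * gauss l m hbar.
Proof.
rewrite /mcoef /twist; congr (_ * _).
have -> : zeta ^- (s * j * l) * q ^- (j * l) = hbar ^+ (j * l).
  by rewrite exprMn !exprVn -mulnA -exprM.
congr (_ * _).
have -> : (m + j - (m + j) %% n = (m + j) %/ n * n)%N.
  by rewrite {1}(divn_eq (m + j) n) addnK.
rewrite mulnA mulnK // -mulnA exprM.
by apply: zmod; rewrite -modnMml modnDmr modnMml.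
Qed.

Let twist_split i l j m a b : (a <= l)%N -> (b <= m)%N ->
  twist ((i + a) %% n) (l - a) ((j + b) %% n) (m - b) * twist i a j b
  = twist i l j m * hbar ^+ (b * (l - a)).
Proof.
move=> le_al le_bm; rewrite /twist.
set r := ((j + b) %% n)%N; set t := ((m - b + r) %/ n)%N.
set c := ((b + j) %/ n)%N.
have Ejb : (j + b = c * n + r)%N by rewrite /c /r [(b + j)%N]addnC -divn_eq.
have -> : ((m + j) %/ n = c + t)%N.
  by rewrite (_ : m + j = c * n + (m - b + r))%N ?divnMDl //; lia.
have Eh : hbar ^+ (j * l) * hbar ^+ (b * (l - a))
    = hbar ^+ (r * (l - a)) * hbar ^+ (j * a) * zeta ^- s ^+ (c * (l - a)).
  have -> : zeta ^- s ^+ (c * (l - a)) = hbar ^+ (n * (c * (l - a))).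
    by rewrite [RHS]exprM hbar_n.
  rewrite -!exprD; congr (_ ^+ _).
  have -> : (j * l = j * (l - a) + j * a)%N by rewrite -mulnDr subnK.
  by rewrite addnAC -mulnDl Ejb; lia.
rewrite [RHS]mulrAC Eh (@zmod _ ((i + l) * t)); last first.
  by rewrite -modnMml modnDml -addnA subnKC // modnMml.
have Ez : (zeta ^+ s) ^+ ((i + l) * (c + t))
   = (zeta ^+ s) ^+ ((i + l) * t) * (zeta ^+ s) ^+ ((i + a) * c) * (zeta ^+ s) ^+ (c * (l - a)).
  rewrite -!exprD; congr (_ ^+ _); nia.
rewrite Ez exprVn; set w := _ ^+ (c * (l - a)).
have w0 : w != 0 by rewrite expf_neq0.
by field.
Qed.

Lemma mcoef_sum i l j m r : (r <= l + m)%N ->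
  \sum_(a < l.+1) \sum_(b < m.+1 | (a + b == r)%N)
     mcoef ((i + a) %% n) (l - a) ((j + b) %% n) (m - b) * mcoef i a j b
  = mcoef i l j m.
Proof.
move=> le_r; rewrite mcoefE gaussE -(subnK le_r) qbin_vandermonde mulr_sumr.
apply: eq_bigr => -[a /= lt_al] _.
have [lt_ra|le_ar] := ltnP r a.
  rewrite big1 => [|b /eqP]; last by lia.
  by rewrite (qbin_small _ lt_ra) !mulr0.
have [lt_m|le_m] := ltnP m (r - a).
  rewrite big1 => [|[b /= lt_bm] /eqP]; last by lia.
  by rewrite [qbin _ (_ - r) _]qbin_small ?mulr0 ?mul0r ?mulr0 //; lia.
have lt_b : (r - a < m.+1)%N by [].
rewrite (big_pred1 (Ordinal lt_b)) /=; last first.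
  by move=> b /=; rewrite -val_eqE /=; apply/eqP/eqP; lia.
rewrite !mcoefE !gaussE mulrACA twist_split //; try lia.
have -> : (a + (r - a) = r)%N by lia.
have -> : (l - a + (m - (r - a)) = l + m - r)%N by lia.
by rewrite !mulrA.
Qed.

(* The coproduct of M(n,s,q) is multiplicative. *)
Lemma coprodM (b c x y : B) :
  \sum_(z : B) mulM b c z * coprod z (x, y)
  = \sum_(u : B * B) \sum_(v : B * B)
      coprod b u * coprod c v * (mulM u.1 v.1 x * mulM u.2 v.2 y).
Proof.
case: b c => [[i i_n] [l l_d]] [[j j_n] [m m_d]].
set b : B := (_, _); set c : B := (_, _).
pose P r := qpath (i + j + r) (l + m - r) x * qpath (i + j) r y.
transitivity (\sum_(r < (l + m).+1) mcoef i l j m * P r).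
  have [lt_d|le_d] := ltnP (l + m) d; last first.
    rewrite !big1 // => [r _|z _]; first by rewrite mcoef_ge ?mul0r.
    by rewrite ffunE /= mcoef_ge // !mul0r.
  pose F (z1 z2 : nat) : K^o :=
    \sum_(r < z2.+1) qpath (z1 + r) (z2 - r) x * qpath z1 r y.
  transitivity (mcoef i l j m * \sum_(z : B) qpath (i + j) (l + m) z *: F z.1 z.2).
    rewrite mulr_sumr; apply: eq_bigr => z _; rewrite ffunE -mulrA.
    congr (_ * (_ * _)); rewrite sum_ffunE; apply: eq_bigr => r _.
    by rewrite ffunE.
  rewrite sum_qpath // mulr_sumr; apply: eq_bigr => r _; congr (_ * (_ * _)).
    by congr (fun_of_fin _ _); apply: qpath_eqmod; rewrite modnDml.
  by rewrite qpath_mod.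
pose mulN i l j m : {ffun B -> K} :=
  [ffun x : B => mcoef i l j m * qpath (i + j) (l + m) x].
pose G u1 u2 u3 u4 v1 v2 v3 v4 : K^o := mulN u1 u2 v1 v2 x * mulN u3 u4 v3 v4 y.
transitivity (\sum_(u : B * B) coprod b u *: \sum_(v : B * B)
   coprod c v *: G u.1.1 u.1.2 u.2.1 u.2.2 v.1.1 v.1.2 v.2.1 v.2.2); last first.
  apply: eq_bigr => u _; rewrite scaler_sumr; apply: eq_bigr => v _.
  by rewrite scalerA.
pose G1 u1 u2 u3 u4 : K^o := \sum_(v : B * B)
   coprod c v *: G u1 u2 u3 u4 v.1.1 v.1.2 v.2.1 v.2.2.
rewrite (sum_coprod G1) /=.
transitivity (\sum_(a < l.+1) \sum_(b < m.+1)
  mcoef ((i + a) %% n) (l - a) ((j + b) %% n) (m - b) * mcoef i a j b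
  * P (a + b)%N); last first.
  apply: eq_bigr => -[a /= a_l] _; rewrite /G1 sum_coprod; apply: eq_bigr => -[e /= e_m] _.
  rewrite /P.
  have -> : qpath (i + j + (a + e)) (l + m - (a + e))
      = qpath ((i + a) %% n + (j + e) %% n) (l - a + (m - e)).
    have -> : (l + m - (a + e) = l - a + (m - e))%N by lia.
    by apply: qpath_eqmod; rewrite modnDm addnACA.
  by rewrite /G /mulN !ffunE; ring.
transitivity (\sum_(r < (l + m).+1) \sum_(a < l.+1) \sum_(e < m.+1 | (a + e == r)%N)
   mcoef ((i + a) %% n) (l - a) ((j + e) %% n) (m - e) * mcoef i a j e * P (a + e)%N).
  apply: eq_bigr => -[r /= lt_r] _.
  rewrite -(@mcoef_sum i l j m r) // mulr_suml; apply: eq_bigr => a _.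
  by rewrite mulr_suml; apply: eq_bigr => e /eqP->.
rewrite exchange_big; apply: eq_bigr => a _.
rewrite (exchange_big_dep predT) //=; apply: eq_bigr => e _.
have lt_ae : (a + e < (l + m).+1)%N by have := ltn_ord a; have := ltn_ord e; lia.
by rewrite (big_pred1 (Ordinal lt_ae)).
Qed.

Lemma counitM (c1 c2 : B) :
  \sum_(b : B) mulM c1 c2 b * counit b = counit c1 * counit c2.
Proof.
case: c1 c2 => [[i i_n] [l l_d]] [[j j_n] [m m_d]]; rewrite /counit /=.
transitivity (mcoef i l j m * (l + m == 0)%N%:R).
  have [lt_d|le_d] := ltnP (l + m) d; last first.
    rewrite mcoef_ge // mul0r big1 // => b _.
    by rewrite ffunE /= mcoef_ge // !mul0r.
  pose F (b1 b2 : nat) : K^o := (b2 == 0)%N%:R.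
  rewrite -[(_ == 0)%N%:R]/(F ((i + j) %% n)%N (l + m)%N).
  rewrite -(@sum_qpath K^o F) // mulr_sumr.
  by apply: eq_bigr => b _; rewrite ffunE -mulrA.
rewrite addn_eq0 -natrM mulnb.
case: eqP => [->|_]; last by rewrite mulr0.
case: eqP => [->|_]; last by rewrite mulr0.
rewrite mcoefE gaussE /twist muln0 !addn0 add0n (divn_small j_n) muln0.
by rewrite qbinN0 !expr0 !mulr1.
Qed.

End CoquasiHopf.

(* Finite-dimensional right comodules.  An element of V (x) M(n,s,q) (x) M(n,s,q)
   is given by its coordinates at pairs (x, y); those of (delta (x) id)(delta v)
   and of (id (x) Delta)(delta v) are the two sides of [coactA].  The comodules
   depend on M(n,s,q) only through its coalgebra, hence only on n and d. *)
Record comodule (K : fieldType) (n d : nat) := Comodule {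
  carrier :> vectType K;
  coact : {linear carrier -> {ffun 'I_n * 'I_d -> carrier}};
  coactA : forall (v : carrier) (x y : 'I_n * 'I_d),
    coact (coact v y) x = \sum_b coprod K b (x, y) *: coact v b;
  coact1 : forall v : carrier, \sum_b counit K b *: coact v b = v
}.

Definition comodule_iso (K : fieldType) (n d : nat) (U W : comodule K n d) :=
  exists f : {linear U -> W},
    bijective f /\ forall (u : U) b, coact W (f u) b = f (coact U u b).

Notation "U \iso W" := (comodule_iso U W) (at level 70, no associativity).

Section DirectSum.
Variables (K : fieldType) (n d : nat).

Definition zero_coact (v : 'rV[K]_0) : {ffun 'I_n * 'I_d -> 'rV[K]_0} := 0.

Fact zero_coact_linear : linear zero_coact.
Proof. by move=> a u v; rewrite /zero_coact scaler0 addr0. Qed.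

HB.instance Definition _ := GRing.isLinear.Build K _ _ _ _ zero_coact_linear.

Fact zero_coactA (v : 'rV[K]_0) (x y : 'I_n * 'I_d) :
  zero_coact (zero_coact v y) x = \sum_b coprod K b (x, y) *: zero_coact v b.
Proof. by rewrite !thinmx0; apply/matrixP => i []. Qed.

Fact zero_coact1 (v : 'rV[K]_0) : \sum_b counit K b *: zero_coact v b = v.
Proof. by apply/matrixP => i []. Qed.

Definition zero_comodule : comodule K n d := Comodule zero_coactA zero_coact1.

Variables U W : comodule K n d.

Definition dsum_coact (v : U * W) : {ffun 'I_n * 'I_d -> (U * W)%type} :=
  [ffun b => (coact U v.1 b, coact W v.2 b)].

Fact dsum_coact_linear : linear dsum_coact.
Proof.
by move=> a u v; apply/ffunP => b; rewrite !ffunE /= !linearP !ffunE.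
Qed.

HB.instance Definition _ := GRing.isLinear.Build K _ _ _ _ dsum_coact_linear.

Fact dsum_coactA (v : U * W) (x y : 'I_n * 'I_d) :
  dsum_coact (dsum_coact v y) x = \sum_b coprod K b (x, y) *: dsum_coact v b.
Proof.
rewrite [LHS]ffunE [dsum_coact v y]ffunE /= !coactA.
rewrite [RHS]surjective_pairing !raddf_sum.
by congr (_, _); apply: eq_bigr => b _; rewrite ffunE.
Qed.

Fact dsum_coact1 (v : U * W) : \sum_b counit K b *: dsum_coact v b = v.
Proof.
rewrite [LHS]surjective_pairing !raddf_sum [RHS]surjective_pairing.
rewrite -[in RHS](coact1 v.1) -[in RHS](coact1 v.2).
by congr (_, _); apply: eq_bigr => b _; rewrite ffunE.
Qed.

Definition dsum : comodule K n d := Comodule dsum_coactA dsum_coact1.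

End DirectSum.

Notation "U \oplus W" := (dsum U W) (at level 50, left associativity).
Notation "\bigoplus_ ( m <= i < p ) F" :=
  (\big[@dsum _ _ _/zero_comodule _ _ _]_(m%N <= i < p%N) F)
  (at level 41, F at level 41, i, m, p at level 50).

(* U (x) W is modelled by matrices: the entry (i, j) is the coordinate at the
   tensor product of the i-th and j-th vectors of the library bases of U and W. *)
Section TensorSpace.
Variables (K : fieldType) (U W : vectType K).

Definition tensor_space : vectType K := 'M[K]_(\dim {:U}, \dim {:W}).

Definition tens (u : U) (w : W) : tensor_space :=
  \matrix_(i, j) (coord (vbasis {:U}) i u * coord (vbasis {:W}) j w).

Lemma tens_suml (I : finType) (F : I -> U) w :
  tens (\sum_i F i) w = \sum_i tens (F i) w.
Proof.
apply/matrixP => i j; rewrite summxE mxE linear_sum mulr_suml.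
by apply: eq_bigr => t _; rewrite mxE.
Qed.

Lemma tens_sumr (I : finType) (F : I -> W) u :
  tens u (\sum_i F i) = \sum_i tens u (F i).
Proof.
apply/matrixP => i j; rewrite summxE mxE linear_sum mulr_sumr.
by apply: eq_bigr => t _; rewrite mxE.
Qed.

Lemma tensZl a u w : tens (a *: u) w = a *: tens u w.
Proof. by apply/matrixP => i j; rewrite !mxE linearZ /= mulrA. Qed.

Lemma tensZr a u w : tens u (a *: w) = a *: tens u w.
Proof. by apply/matrixP => i j; rewrite !mxE linearZ /= mulrCA. Qed.

Lemma tensor_spaceE (t : tensor_space) :
  t = \sum_i \sum_j t i j *: tens (vbasis {:U})`_i (vbasis {:W})`_j.
Proof.
apply/matrixP => i j.
have bas (i' : 'I_(\dim {:U})) (j' : 'I_(\dim {:W})) :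
    tens (vbasis {:U})`_i' (vbasis {:W})`_j' i j
    = (i' == i)%:R * (j' == j)%:R.
  by rewrite mxE !coord_free ?(basis_free (vbasisP {:U})) ?(basis_free (vbasisP {:W})).
rewrite summxE (bigD1 i) //= summxE (bigD1 j) //= mxE bas !eqxx !mulr1.
rewrite !big1 ?addr0 // => [i' ni|j' nj]; last first.
  by rewrite mxE bas (negbTE nj) !mulr0.
rewrite summxE big1 // => j' _.
by rewrite mxE bas (negbTE ni) mul0r mulr0.
Qed.

End TensorSpace.

(* The coaction u (x) w |-> \sum u_(0) (x) w_(0) (x) u_(1) w_(1), extended
   linearly from the tensor products of basis vectors; [tensor_coactE] is this
   formula for arbitrary u and w. *)
Section Tensor.
Variables (K : fieldType) (n s d : nat) (zeta q : K).
Hypothesis H : admissible n s d zeta q.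
Variables U W : comodule K n d.
Local Notation B := ('I_n * 'I_d)%type.
Local Notation UW := (tensor_space U W).

Definition tensor_coact (t : UW) : {ffun B -> UW} :=
  [ffun b => \sum_i \sum_j t i j *: \sum_c1 \sum_c2 mulM s zeta q c1 c2 b *:
     tens (coact U (vbasis {:U})`_i c1) (coact W (vbasis {:W})`_j c2)].

Fact tensor_coact_linear : linear tensor_coact.
Proof.
move=> a u v; apply/ffunP => b; rewrite !ffunE scaler_sumr -big_split.
apply: eq_bigr => i _; rewrite scaler_sumr -big_split.
by apply: eq_bigr => j _; rewrite !mxE scalerDl scalerA.
Qed.

HB.instance Definition _ := GRing.isLinear.Build K _ _ _ _ tensor_coact_linear.

Let tensor_coactP b a u v :
  tensor_coact (a *: u + v) b = a *: tensor_coact u b + tensor_coact v b.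
Proof. by rewrite linearP [LHS]ffunE [X in X + _]ffunE. Qed.

Lemma tensor_coactE u w b : tensor_coact (tens u w) b =
  \sum_c1 \sum_c2 mulM s zeta q c1 c2 b *: tens (coact U u c1) (coact W w c2).
Proof.
rewrite ffunE.
transitivity (\sum_c1 \sum_c2 mulM s zeta q c1 c2 b *:
   \sum_i \sum_j (tens u w) i j *:
     tens (coact U (vbasis {:U})`_i c1) (coact W (vbasis {:W})`_j c2)).
  under [RHS]eq_bigr => c1 _ do under eq_bigr => c2 _ do rewrite scaler_sumr.
  under [RHS]eq_bigr => c1 _ do rewrite exchange_big.
  rewrite [RHS]exchange_big; apply: eq_bigr => i _ /=.
  under [RHS]eq_bigr => c1 _ do under eq_bigr => c2 _ do rewrite scaler_sumr.
  under [RHS]eq_bigr => c1 _ do rewrite exchange_big.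
  rewrite [RHS]exchange_big; apply: eq_bigr => j _ /=.
  rewrite scaler_sumr; apply: eq_bigr => c1 _.
  rewrite scaler_sumr; apply: eq_bigr => c2 _.
  by rewrite !scalerA mulrC.
apply: eq_bigr => c1 _; apply: eq_bigr => c2 _; congr (_ *: _).
rewrite {2}(coord_vbasis (memvf u)) {2}(coord_vbasis (memvf w)).
rewrite linear_sum sum_ffunE tens_suml; apply: eq_bigr => i _.
rewrite linear_sum sum_ffunE tens_sumr; apply: eq_bigr => j _.
by rewrite !linearZ !ffunE /= tensZl tensZr scalerA mxE.
Qed.

Lemma tensor_ext (V : lmodType K) (f g : {linear UW -> V}) :
  (forall u w, f (tens u w) = g (tens u w)) -> f =1 g.
Proof.
move=> eq_fg t; rewrite (tensor_spaceE t) !linear_sum; apply: eq_bigr => i _.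
rewrite !linear_sum; apply: eq_bigr => j _.
by rewrite !linearZ eq_fg.
Qed.

Fact tensor_coactA (t : UW) (x y : B) :
  tensor_coact (tensor_coact t y) x = \sum_b coprod K b (x, y) *: tensor_coact t b.
Proof.
pose f t := tensor_coact (tensor_coact t y) x.
pose g t : UW := \sum_b coprod K b (x, y) *: tensor_coact t b.
have f_lin : linear f by move=> a u v; rewrite /f !tensor_coactP.
have g_lin : linear g.
  move=> a u v; rewrite /g scaler_sumr -big_split; apply: eq_bigr => b _.
  by rewrite tensor_coactP scalerDr !scalerA mulrC.
pose F : {linear UW -> UW} := HB.pack f (GRing.isLinear.Build _ _ _ _ _ f_lin).
pose G : {linear UW -> UW} := HB.pack g (GRing.isLinear.Build _ _ _ _ _ g_lin).
apply: (@tensor_ext _ F G) => u w {t}; rewrite /= /f /g.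
transitivity (\sum_(c1 : B) \sum_(c2 : B) (\sum_(p : B * B) \sum_(r : B * B)
   coprod K c1 p * coprod K c2 r
     * (mulM s zeta q p.1 r.1 x * mulM s zeta q p.2 r.2 y)) *:
   tens (coact U u c1) (coact W w c2)); last first.
  under [RHS]eq_bigr => b _ do rewrite tensor_coactE scaler_sumr.
  rewrite [RHS]exchange_big; apply: eq_bigr => c1 _ /=.
  under [RHS]eq_bigr => b _ do rewrite scaler_sumr.
  rewrite [RHS]exchange_big; apply: eq_bigr => c2 _ /=.
  rewrite -(coprodM H) scaler_suml; apply: eq_bigr => b _.
  by rewrite scalerA mulrC.
rewrite tensor_coactE linear_sum sum_ffunE.
under eq_bigr => b1 _ do rewrite linear_sum sum_ffunE.
transitivity (\sum_(b1 : B) \sum_(b2 : B) \sum_(a1 : B) \sum_(a2 : B)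
   \sum_(c1 : B) \sum_(c2 : B)
     (coprod K c1 (a1, b1) * coprod K c2 (a2, b2)
      * (mulM s zeta q a1 a2 x * mulM s zeta q b1 b2 y))
     *: tens (coact U u c1) (coact W w c2)).
  apply: eq_bigr => b1 _; apply: eq_bigr => b2 _.
  rewrite linearZ ffunE /= tensor_coactE scaler_sumr; apply: eq_bigr => a1 _.
  rewrite scaler_sumr; apply: eq_bigr => a2 _.
  rewrite !coactA scalerA tens_suml scaler_sumr; apply: eq_bigr => c1 _.
  rewrite tens_sumr scaler_sumr; apply: eq_bigr => c2 _.
  by rewrite tensZl tensZr !scalerA; congr (_ *: _); ring.
transitivity (\sum_(b1 : B) \sum_(a1 : B) \sum_(b2 : B) \sum_(a2 : B)
   \sum_(c1 : B) \sum_(c2 : B)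
     (coprod K c1 (a1, b1) * coprod K c2 (a2, b2)
      * (mulM s zeta q a1 a2 x * mulM s zeta q b1 b2 y))
     *: tens (coact U u c1) (coact W w c2)).
  by apply: eq_bigr => b1 _; rewrite exchange_big.
rewrite exchange_big pair_big.
transitivity (\sum_(p : B * B) \sum_(r : B * B) \sum_(c1 : B) \sum_(c2 : B)
     (coprod K c1 p * coprod K c2 r
      * (mulM s zeta q p.1 r.1 x * mulM s zeta q p.2 r.2 y))
     *: tens (coact U u c1) (coact W w c2)).
  apply: eq_bigr => -[a1 b1] _; rewrite exchange_big pair_big.
  by apply: eq_bigr => -[a2 b2].
under eq_bigr => p _ do rewrite exchange_big.
rewrite exchange_big; apply: eq_bigr => c1 _ /=.
under eq_bigr => p _ do rewrite exchange_big.
rewrite exchange_big; apply: eq_bigr => c2 _ /=.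
by rewrite scaler_suml; apply: eq_bigr => p _; rewrite scaler_suml.
Qed.

Fact tensor_coact1 (t : UW) : \sum_b counit K b *: tensor_coact t b = t.
Proof.
pose g t : UW := \sum_b counit K b *: tensor_coact t b.
have g_lin : linear g.
  move=> a u v; rewrite /g scaler_sumr -big_split; apply: eq_bigr => b _.
  by rewrite tensor_coactP scalerDr !scalerA mulrC.
pose G : {linear UW -> UW} := HB.pack g (GRing.isLinear.Build _ _ _ _ _ g_lin).
apply: (@tensor_ext _ G idfun) => u w {t}; rewrite /= /g.
under eq_bigr => b _ do rewrite tensor_coactE scaler_sumr.
rewrite exchange_big -[in RHS](coact1 u) tens_suml; apply: eq_bigr => c1 _ /=.
under eq_bigr => b _ do rewrite scaler_sumr.
rewrite exchange_big -[in RHS](coact1 w) tens_sumr; apply: eq_bigr => c2 _ /=.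
rewrite tensZl tensZr scalerA -(counitM H) scaler_suml; apply: eq_bigr => b _.
by rewrite scalerA mulrC.
Qed.

Definition tensor : comodule K n d := Comodule tensor_coactA tensor_coact1.

End Tensor.

Section Indecomposables.
Variables (K : fieldType) (n s d : nat) (zeta q : K).
Hypothesis H : admissible n s d zeta q.
Variables (i : nat) (e : 'I_d).
Local Notation B := ('I_n * 'I_d)%type.
Local Notation Ve := 'rV[K]_e.+1.

(* The basis vector v_m^i is [delta_mx 0 m]. *)
Definition indec_coact (v : Ve) : {ffun B -> Ve} :=
  \sum_(m < e.+1) v 0 m *: \sum_(x < e.+1 | (m <= x)%N)
     [ffun b => qpath K n d (i + m) (x - m) b *: delta_mx 0 x].

Fact indec_coact_linear : linear indec_coact.
Proof.
move=> a u v; rewrite /indec_coact scaler_sumr -big_split.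
by apply: eq_bigr => m _; rewrite !mxE scalerDl scalerA.
Qed.

HB.instance Definition _ := GRing.isLinear.Build K _ _ _ _ indec_coact_linear.

Let indec_coact_delta (m : 'I_e.+1) b : indec_coact (delta_mx 0 m) b =
  \sum_(x < e.+1 | (m <= x)%N) qpath K n d (i + m) (x - m) b *: delta_mx 0 x.
Proof.
rewrite /indec_coact (bigD1 m) //= mxE !eqxx scale1r [X in _ + X]big1 => [|m' ne].
  by rewrite addr0 sum_ffunE; apply: eq_bigr => x _; rewrite ffunE.
by rewrite mxE (negbTE ne) andbF scale0r.
Qed.

Let indec_ext (f g : {linear Ve -> Ve}) :
  (forall m, f (delta_mx 0 m) = g (delta_mx 0 m)) -> f =1 g.
Proof.
move=> eq_fg v; rewrite (row_sum_delta v) !linear_sum.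
by apply: eq_bigr => m _; rewrite !linearZ eq_fg.
Qed.

Let indec_coactP b a u v :
  indec_coact (a *: u + v) b = a *: indec_coact u b + indec_coact v b.
Proof. by rewrite linearP [LHS]ffunE [X in X + _]ffunE. Qed.

Let sum_interval (F : nat -> Ve) m w : (m <= w)%N -> (w <= e)%N ->
  \sum_(z < e.+1 | (m <= z)%N && (z <= w)%N) F z
  = \sum_(r < (w - m).+1) F (m + r)%N.
Proof.
move=> le_mw le_we; rewrite -(big_mkord (fun z => (m <= z)%N && (z <= w)%N) F).
rewrite -(big_mkord predT (fun r => F (m + r)%N)) -subSn //.
transitivity (\sum_(m <= z < w.+1) F z).
  by rewrite (@big_nat_widenl _ _ _ m 0) // (@big_nat_widen _ _ _ _ w.+1 e.+1).
by rewrite -{1}[m]add0n big_addn; apply: eq_bigr => r _; rewrite addnC.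
Qed.

Fact indec_coactA (v : Ve) (x y : B) :
  indec_coact (indec_coact v y) x = \sum_b coprod K b (x, y) *: indec_coact v b.
Proof.
pose f t := indec_coact (indec_coact t y) x.
pose g t : Ve := \sum_b coprod K b (x, y) *: indec_coact t b.
have f_lin : linear f by move=> a u w; rewrite /f !indec_coactP.
have g_lin : linear g.
  move=> a u w; rewrite /g scaler_sumr -big_split; apply: eq_bigr => b _.
  by rewrite indec_coactP scalerDr !scalerA mulrC.
pose F : {linear Ve -> Ve} := HB.pack f (GRing.isLinear.Build _ _ _ _ _ f_lin).
pose G : {linear Ve -> Ve} := HB.pack g (GRing.isLinear.Build _ _ _ _ _ g_lin).
apply: (@indec_ext F G) => m {v}; rewrite /= /f /g.
transitivity (\sum_(w < e.+1 | (m <= w)%N) (\sum_(r < (w - m).+1)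
  qpath K n d (i + m + r) (w - m - r) x * qpath K n d (i + m) r y)
    *: delta_mx 0 w : Ve).
  rewrite indec_coact_delta linear_sum sum_ffunE.
  under eq_bigr => z _ do rewrite linearZ ffunE /= indec_coact_delta scaler_sumr.
  rewrite (exchange_big_dep (fun w : 'I_e.+1 => m <= w)%N) /=; last first.
    by move=> z w; apply: leq_trans.
  apply: eq_bigr => w le_mw; rewrite scaler_suml.
  pose T z : Ve := qpath K n d (i + m) (z - m) y *:
                   (qpath K n d (i + z) (w - z) x *: delta_mx 0 w).
  rewrite (@sum_interval T) //; last by rewrite -ltnS.
  by apply: eq_bigr => r _; rewrite /T addKn addnA subnDA scalerA mulrC.
transitivity (\sum_(b : B) \sum_(w < e.+1 | (m <= w)%N)
    (coprod K b (x, y) * qpath K n d (i + m) (w - m) b) *: (delta_mx 0 w : Ve)).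
  rewrite exchange_big; apply: eq_bigr => w le_mw; rewrite -scaler_suml.
  congr (_ *: _).
  pose Fn (b1 b2 : nat) : K^o := \sum_(r < b2.+1)
     qpath K n d (b1 + r) (b2 - r) x * qpath K n d b1 r y.
  transitivity (\sum_(b : B) qpath K n d (i + m) (w - m) b *: Fn b.1 b.2); last first.
    apply: eq_bigr => b _; rewrite [RHS]mulrC; congr (_ * _).
    by rewrite sum_ffunE; apply: eq_bigr => r _; rewrite [RHS]ffunE.
  have lt_d : (w - m < d)%N by have := ltn_ord w; have := ltn_ord e; lia.
  rewrite (sum_qpath H Fn (i + m)%N lt_d); apply: eq_bigr => r _; rewrite qpath_mod.
  congr (_ * _); congr (fun_of_fin _ _); apply: qpath_eqmod.
  by rewrite modnDml.
apply: eq_bigr => b _; rewrite indec_coact_delta scaler_sumr.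
by apply: eq_bigr => w _; rewrite scalerA.
Qed.

Fact indec_coact1 (v : Ve) : \sum_b counit K b *: indec_coact v b = v.
Proof.
pose g t : Ve := \sum_b counit K b *: indec_coact t b.
have g_lin : linear g.
  move=> a u w; rewrite /g scaler_sumr -big_split; apply: eq_bigr => b _.
  by rewrite indec_coactP scalerDr !scalerA mulrC.
pose G : {linear Ve -> Ve} := HB.pack g (GRing.isLinear.Build _ _ _ _ _ g_lin).
apply: (@indec_ext G idfun) => m {v}; rewrite /= /g.
under eq_bigr => b _ do rewrite indec_coact_delta scaler_sumr.
rewrite exchange_big /= (bigD1 m) //= [X in _ + X]big1 => [|x /andP[le_mx ne]].
  rewrite addr0.
  under eq_bigr => b _ do rewrite scalerA mulrC.
  rewrite -scaler_suml subnn.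
  pose F (b1 b2 : nat) : K^o := (b2 == 0)%N%:R.
  have d_gt0 : (0 < d)%N by apply: leq_trans (ltn_ord e).
  by rewrite (sum_qpath H F) // /F eqxx scale1r.
under eq_bigr => b _ do rewrite scalerA mulrC.
rewrite -scaler_suml.
pose F (b1 b2 : nat) : K^o := (b2 == 0)%N%:R.
have lt_d : (x - m < d)%N by have := ltn_ord x; have := ltn_ord e; lia.
rewrite (sum_qpath H F) // /F (_ : (x - m == 0)%N = false) ?scale0r //.
by apply/negbTE; move: ne; rewrite -val_eqE /=; lia.
Qed.

Definition indec_ord : comodule K n d := Comodule indec_coactA indec_coact1.

End Indecomposables.

(* V(i, e).  Its first index is read modulo n (through [qpath]); it only makes
   sense for e < d, and the value at the other e is a dummy. *)
Definition indec (K : fieldType) (n s d : nat) (zeta q : K)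
    (H : admissible n s d zeta q) (i e : nat) : comodule K n d :=
  if insub e is Some e' then indec_ord H i e' else zero_comodule K n d.

(* Main.v *)
From HB Require Import structures.
Require Import Defs.
From mathcomp Require Import all_boot all_order all_algebra.
From mathcomp Require Import ring zify.

(* A comodule over M(n,s,q) is a Z/n-graded space with an operator N of degree 1 such
   that N^d = 0, and V(i,e) is a single Jordan block of length e+1 starting in degree i.
   On V(i,e) (x) V(j,f) the basis vectors can be rescaled to y_(a,b) with
   N y_(a,b) = h^b y_(a+1,b) + y_(a,b+1), where h = zeta^(-s) q^(-1) has order d; so the
   tensor product is F[N,Z] / (Z^(e+1), P) as an F[N]-module, where P is the product of
   the N - h^i Z for i <= f.  Let e <= f.  By Nakayama, homogeneous elements g_k of
   degree k = 0, ..., e that contain Z^k generate it.  If k = 0 or e + f + 1 < d + k,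
   then g_k can be chosen with N^(e+f-2k+1) g_k = 0: at N = 1 this is a Pade approximation
   problem for P modulo Z^(e+1), whose solution has degree exactly k by a comparison with
   its dilation Z |-> h Z.  For the other k, take g_k = Z^k, killed by N^d.  The resulting
   surjection from a sum of blocks is an isomorphism because the dimensions agree.  The
   case e > f follows by exchanging the factors, which inverts h. *)

Set Implicit Arguments.
Unset Strict Implicit.
Unset Printing Implicit Defensive.

Import GRing.Theory.
Local Open Scope ring_scope.

(** * Padé approximation of q-Pochhammer polynomials *)

(** The [e - k + 1] coefficients of [B] must make the coefficients of [B * P] of index [k + 1] to
    [e] vanish. These are [e - k] linear equations, so [M] has a nonzero left kernel; [g] is then
    the truncation of [B * P]. *)
Lemma pade_exists (F : fieldType) (P : {poly F}) (e k : nat) : (k <= e)%N ->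
  exists B g : {poly F}, [/\ B != 0, (size B <= (e - k).+1)%N, (size g <= k.+1)%N
    & 'X^(e.+1) %| B * P - g].
Proof.
move=> le_ke.
pose M : 'M[F]_((e - k).+1, e - k) := \matrix_(i, j) ('X^i * P)`_(k.+1 + j).
have : kermx M != 0.
  rewrite -mxrank_eq0 mxrank_ker subn_eq0 -ltnNge ltnS; exact: rank_leq_col.
case/rowV0Pn => v /sub_kermxP vM v_neq0.
exists (rVpoly v), (take_poly k.+1 (rVpoly v * P)); split.
- by apply: contra v_neq0 => /eqP v0; rewrite -(rVpolyK v) v0 linear0.
- exact: size_poly.
- exact: size_take_poly.
set Q := _ * P; have low j : (k < j <= e)%N -> Q`_j = 0.
  move=> /andP[lt_kj le_je]; have lt_j : (j - k.+1 < e - k)%N by lia.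
  have /rowP/(_ (Ordinal lt_j)) := vM; rewrite !mxE; apply: etrans.
  have -> : Q = \sum_i v 0 i *: ('X^i * P).
    rewrite /Q [rVpoly v]poly_def mulr_suml; apply: eq_bigr => i _.
    by rewrite valK -scalerAl.
  by rewrite coef_sum; apply: eq_bigr => i _; rewrite mxE /= subnKC // coefZ.
have -> : Q - take_poly k.+1 Q = drop_poly e.+1 Q * 'X^(e.+1); last exact: dvdp_mull.
apply/polyP => j; rewrite coefB coefMXn coef_take_poly coef_drop_poly.
case: (ltnP j k.+1) => le_kj; case: (ltnP j e.+1) => le_ej; rewrite ?subrr ?subr0 //.
- lia.
- by rewrite low // le_kj.
- by rewrite subnK.
Qed.

(** The q-Pochhammer symbol (X; h)_m, obtained from the product of the N - h^i Z for i < m by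
    setting N = 1 and Z = X. *)
Definition qpochhammer (F : fieldType) (h : F) (m : nat) : {poly F} :=
  \prod_(i < m) (1 - h ^+ i *: 'X).

Section Pade.
Variables (F : fieldType) (h : F).
Local Notation P := (qpochhammer h).
Local Notation dil := (comp_poly (h *: 'X)).

Lemma qpochhammerS m : P m.+1 = P m * (1 - h ^+ m *: 'X).
Proof. by rewrite /P big_ord_recr. Qed.

(** Dilation moves each factor to the next one, so only the two end factors change. *)
Lemma qpochhammer_dilate m : dil (P m) * (1 - 'X) = P m * (1 - h ^+ m *: 'X).
Proof.
elim: m => [|m IH]; first by rewrite /P !big_ord0 comp_polyC scale1r.
rewrite qpochhammerS comp_polyM mulrAC IH -!mulrA; congr (_ * _).
rewrite comp_polyB comp_polyC comp_polyZ comp_polyX scalerA -exprSr mulrC //.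
Qed.

Lemma qpochhammer_coprimeX m e : coprimep 'X^e (P m).
Proof.
apply: coprimep_expl; rewrite coprimep_sym -['X]subr0 -polyC0 coprimep_XsubC.
rewrite /root /P horner_prod big1 ?oner_eq0 // => i _.
by rewrite !hornerE subr0.
Qed.

Lemma lead_coef_dilate (p : {poly F}) : h != 0 ->
  lead_coef (dil p) = lead_coef p * h ^+ (size p).-1.
Proof.
move=> h0; rewrite lead_coef_comp ?size_scale ?size_polyX //.
by rewrite lead_coefZ lead_coefX mulr1.
Qed.

(* Comparing with the dilation [Z |-> h Z] turns the congruence [B P = g] modulo
   [Z^(e+1)] into an identity of polynomials of degree at most [e], whose leading
   coefficients force [h ^ (m + deg B - deg g) = 1], impossible if [deg g < k]. *)
Lemma pade_normal (d e m k : nat) (B g : {poly F}) :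
  (forall l, (d %| l)%N = (h ^+ l == 1)) -> (0 < d)%N ->
  (k <= e)%N -> (e < m)%N -> (k == 0)%N || (m + e < d + k)%N ->
  B != 0 -> (size B <= (e - k).+1)%N -> (size g <= k.+1)%N ->
  'X^(e.+1) %| B * P m - g -> size g = k.+1.
Proof.
move=> ord_h d_gt0 le_ke lt_em hk B0 sB sg dvd_g.
have h0 : h != 0.
  have /esym := ord_h d; rewrite dvdnn; apply: contraTneq => ->.
  by rewrite expr0n gtn_eqF //= eq_sym oner_eq0.
have g0 : g != 0.
  apply: contraTneq dvd_g => ->; rewrite subr0 Gauss_dvdpl ?qpochhammer_coprimeX //.
  by apply/negP => /(dvdp_leq B0) /leq_trans /(_ sB); rewrite size_polyXn; lia.
have g1 : (0 < size g)%N by rewrite size_poly_gt0.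
have B1 : (0 < size B)%N by rewrite size_poly_gt0.
suff: ~~ (size g <= k)%N by lia.
apply/negP => sg'.
(* For [k = 0] the assumed bound would force [g = 0], so the second alternative of [hk] holds. *)
have k_gt0 : (0 < k)%N by lia.
rewrite gtn_eqF //= in hk.
set T : {poly F} := 1 - h ^+ m *: 'X.
have Tn0 : size T = 2%N.
  rewrite /T addrC size_polyDl size_polyN size_scale ?expf_neq0 ?size_polyX ?size_poly1 //.
have T1n : size (1 - 'X : {poly F}) = 2%N.
  by rewrite -[1 - _]opprB size_polyN size_XsubC.
(* [qpochhammer_dilate] eliminates [P m] between the congruence and its dilation, so X^(e+1) divides
   this difference. Its degree is at most [e] because [size g <= k], hence it is zero. *)
have key : dil g * (1 - 'X) * B - dil B * T * g = 0.
  apply/eqP; apply/negPn/negP => Q0.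
  have : 'X^(e.+1) %| dil g * (1 - 'X) * B - dil B * T * g.
    have /dvdpP[A defA] := dvd_g.
    have -> : g = B * P m - A * 'X^(e.+1) by rewrite -defA subKr.
    have -> : dil (B * P m - A * 'X^(e.+1)) * (1 - 'X)
       = dil B * P m * T - dil A * (h ^+ e.+1 *: 'X^(e.+1)) * (1 - 'X).
      rewrite comp_polyB !comp_polyM comp_Xn_poly exprZn mulrBl -!mulrA.
      by rewrite qpochhammer_dilate.
    rewrite (_ : _ - _ = (dil B * T * A - dil A * (h ^+ e.+1)%:P * (1 - 'X) * B) * 'X^(e.+1)).
      exact: dvdp_mull.
    by rewrite -[_ *: 'X^_]mul_polyC; ring.
  have sM (a b c : nat) (p r : {poly F}) : (size p <= a)%N -> (size r <= b)%N ->
      (a + b <= c.+1)%N -> (size (p * r)%R <= c)%N.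
    by move=> pa rb le_c; apply: leq_trans (size_polyMleq p r) _; lia.
  have sdil (p : {poly F}) : size (dil p) = size p.
    by rewrite size_comp_poly2 // size_scale ?size_polyX.
  have s1 : (size (dil g * (1 - 'X) * B)%R <= e.+1)%N.
    apply: (sM k.+1 (e - k).+1) => //; last by lia.
    by apply: (sM k 2); rewrite ?sdil ?T1n //; lia.
  have s2 : (size (dil B * T * g)%R <= e.+1)%N.
    apply: (sM (e - k).+2 k) => //; last by lia.
    by apply: (sM (e - k).+1 2); rewrite ?sdil ?Tn0 //; lia.
  have := size_polyD (dil g * (1 - 'X) * B) (- (dil B * T * g)).
  rewrite size_polyN => le_Q /(dvdp_leq Q0) /leq_trans /(_ le_Q).
  by rewrite size_polyXn leq_max !ltnNge s1 s2.
have lT : lead_coef T = - h ^+ m.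
  by rewrite lead_coefE Tn0 /T !coefE /= sub0r mulr1.
have lT1 : lead_coef (1 - 'X : {poly F}) = -1.
  by rewrite lead_coefE T1n !coefE sub0r.
have := congr1 lead_coef (subr0_eq key).
rewrite !lead_coefM !lead_coef_dilate // lT lT1.
set a := lead_coef g; set b := lead_coef B => eq_lead.
have ab0 : a * b != 0 by rewrite mulf_neq0 ?lead_coef_eq0.
have e1 : h ^+ (size g).-1 = h ^+ ((size B).-1 + m).
  by apply: (mulfI ab0); apply: oppr_inj; rewrite exprD; move: eq_lead => /= E; ring: E.
(* This exponent is at least [m - k + 1], which is positive, and at most [m + e - k], which is less
   than [d]. *)
have : (d %| (size B).-1 + m - (size g).-1)%N.
  rewrite ord_h -(inj_eq (mulfI (expf_neq0 (size g).-1 h0))) -exprD mulr1 e1.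
  by apply/eqP; congr (_ ^+ _); lia.
by move/dvdn_leq; lia.
Qed.

End Pade.

(** * Modules with quantum plane relations *)

Section QuantumPlane.
Variables (F : fieldType) (V : vectType F) (N : {linear V -> V}) (h : F) (e f : nat).
Variable y : nat -> nat -> V.
Hypothesis N_y : forall a b, N (y a b) = h ^+ b *: y a.+1 b + y a b.+1.
Hypothesis y_gtl : forall a b, (e < a)%N -> y a b = 0.
Hypothesis y_gtr : forall a b, (f < b)%N -> y a b = 0.
Local Notation P := (qpochhammer h).

(* The value of the degree [k] homogenisation of [g], read in the commutative
   algebra [F[N, Z] / (Z^(e+1), \prod_(i <= f) (N - h^i Z))], where [Z^a] stands
   for [y a 0]. *)
Definition homogenize (k : nat) (g : {poly F}) : V :=
  \sum_(a < k.+1) g`_a *: iter (k - a) N (y a 0).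

Lemma homogenize_is_linear k : linear (homogenize k).
Proof.
move=> c p r; rewrite /homogenize scaler_sumr -big_split; apply: eq_bigr => a _.
by rewrite coefD coefZ scalerDl scalerA.
Qed.

HB.instance Definition _ k :=
  GRing.isLinear.Build F {poly F} V _ (homogenize k) (homogenize_is_linear k).

(** Since [g] has no coefficient beyond index [k], raising the degree only adds a factor N to each
    term and creates no new term. *)
Lemma iter_homogenize k m (g : {poly F}) : (size g <= k.+1)%N ->
  iter m N (homogenize k g) = homogenize (k + m) g.
Proof.
move=> sg; elim: m => [|m IH]; first by rewrite addn0.
rewrite iterS {}IH addnS /homogenize [RHS]big_ord_recr /= linear_sum /=.
rewrite [X in X *: _]nth_default ?scale0r ?addr0; last by rewrite (leq_trans sg) //; lia.
apply: eq_bigr => -[a lt_a] _ /=; rewrite linearZ /= subSn //; lia.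
Qed.

Lemma size_qpochhammer m : (size (P m) <= m.+1)%N.
Proof.
elim: m => [|m IH]; first by rewrite /qpochhammer big_ord0 size_poly1.
rewrite qpochhammerS; apply: leq_trans (size_polyMleq _ _) _.
have sT : (size (1 - h ^+ m *: 'X : {poly F})%R <= 2)%N.
  apply: leq_trans (size_polyD _ _) _; rewrite size_polyN geq_max size_poly1 /=.
  by apply: leq_trans (size_scale_leq _ _) _; rewrite size_polyX.
by have := leq_add IH sT; lia.
Qed.

(** Read as y_(a,b+1) = (N - h^b Z) y_(a,b), the relation [N_y] is multiplication by the
    homogenisation of 1 - h^b X; induct on [b]. *)
Lemma homogenize_XP a b : homogenize (a + b) ('X^a * P b) = y a b.
Proof.
elim: b a => [|b IH] a.
  rewrite /qpochhammer big_ord0 mulr1 addn0 /homogenize big_ord_recr /=.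
  rewrite coefXn eqxx scale1r subnn big1 ?add0r // => -[c lt_c] _ /=.
  by rewrite coefXn ltn_eqF // scale0r.
have -> : 'X^a * P b.+1 = 'X^a * P b - h ^+ b *: ('X^(a.+1) * P b).
  by rewrite qpochhammerS exprSr -!mul_polyC; ring.
rewrite linearB linearZ /= addnS -{2}addSn IH -[(a + b).+1]addn1 -iter_homogenize /=.
  by rewrite IH N_y addrC addKr.
apply: leq_trans (size_polyMleq _ _) _; rewrite size_polyXn.
by have := size_qpochhammer b; lia.
Qed.

Lemma homogenize_dvdX k (A : {poly F}) : homogenize k (A * 'X^(e.+1)) = 0.
Proof.
rewrite /homogenize big1 // => a _; rewrite coefMXn.
case: ltnP => [_|le_ea]; first by rewrite scale0r.
rewrite y_gtl //; suff -> : iter (k - a) N 0 = 0 by rewrite scaler0.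
by elim: (k - a)%N => //= l ->; rewrite linear0.
Qed.

(** A monomial X^a of [B] contributes N^(c-a) applied to [y a f.+1], which is zero by [y_gtr]. *)
Lemma homogenize_mulP c (B : {poly F}) : (size B <= c.+1)%N ->
  homogenize (c + f.+1) (B * P f.+1) = 0.
Proof.
move=> sB; have -> : B = \sum_(a < c.+1) B`_a *: 'X^a.
  apply/polyP => l; rewrite -[RHS]/((\sum_(a < c.+1) B`_a *: 'X^a)`_l) -poly_def coef_poly.
  by case: ltnP => // le_cl; rewrite nth_default // (leq_trans sB).
rewrite mulr_suml linear_sum big1 // => -[a le_ac] _ /=.
rewrite -scalerAl linearZ /=.
have -> : (c + f.+1 = a + f.+1 + (c - a))%N by lia.
rewrite -iter_homogenize.
  rewrite homogenize_XP y_gtr //; elim: (c - a)%N => [|m IH]; first by rewrite scaler0.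
  by rewrite iterS -linearZ IH linear0.
apply: leq_trans (size_polyMleq _ _) _; rewrite size_polyXn.
by have := size_qpochhammer f.+1; lia.
Qed.

(** Take the Padé numerator [g] of [P f.+1]. Applying N^(e+f-2k+1) brings it to degree (e - k) + (f
    + 1). There [g], written as [B * P f.+1] minus a multiple of X^(e+1), is a difference of two
    terms that vanish. *)
Lemma primitive_generator d k :
    (forall l, (d %| l)%N = (h ^+ l == 1)) -> (0 < d)%N ->
    (e <= f)%N -> (k <= e)%N -> (k == 0)%N || (e + f < d + k - 1)%N ->
  exists2 g : {poly F}, size g = k.+1 &
    iter (e + f - 2 * k).+1 N (homogenize k g) = 0.
Proof.
move=> ord_h d_gt0 le_ef le_ke hk.
have [B [g [B0 sB sg dvd_g]]] := pade_exists (P f.+1) le_ke; exists g.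
  apply: (pade_normal ord_h d_gt0 le_ke _ _ B0 sB sg dvd_g) => //.
  by case/orP: hk => [->//|]; lia.
rewrite iter_homogenize //.
have /dvdpP[A defA] := dvd_g.
have -> : g = B * P f.+1 - A * 'X^(e.+1) by rewrite -defA subKr.
rewrite linearB /= homogenize_dvdX subr0.
have -> : (k + (e + f - 2 * k).+1 = e - k + f.+1)%N by lia.
exact: homogenize_mulP.
Qed.

(** Graded Nakayama argument: up to a nonzero scalar, the generator of degree [a] is [y a 0] plus
    N-multiples of the [y c 0] with [c < a]. Induction on [a] puts every [y a 0] in [S], and [N_y]
    then gives every [y a b]. *)
Lemma generators_span (S : {vspace V}) :
    (forall v, v \in S -> N v \in S) ->
    (forall k, (k <= e)%N -> exists2 g : {poly F}, size g = k.+1 & homogenize k g \in S) ->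
  forall a b, y a b \in S.
Proof.
move=> N_S gens.
have iter_S m v : v \in S -> iter m N v \in S by elim: m => //= m IH /IH/N_S.
suff yS a : y a 0 \in S.
  move=> a b; elim: b a => [//|b IH] a.
  by rewrite -[y a b.+1](addKr (h ^+ b *: y a.+1 b)) -N_y rpredD ?rpredN ?rpredZ ?N_S.
elim/ltn_ind: a => a IH; have [lt_ea|le_ae] := ltnP e a; first by rewrite y_gtl ?rpred0.
have [g sg] := gens a le_ae; rewrite /homogenize big_ord_recr /= subnn /= => gS.
have lead0 : g`_a != 0.
  by have := lead_coef_eq0 g; rewrite lead_coefE sg /= => ->; rewrite -size_poly_eq0 sg.
rewrite -[y a 0](scalerK lead0) rpredZ //; move: gS; rewrite rpredDl //.
by apply: rpred_sum => c _; rewrite rpredZ ?iter_S ?IH.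
Qed.

End QuantumPlane.

(** * Comodules as graded spaces with a shift operator *)

Section Comodules.
Variables (K : fieldType) (n d : nat).
Implicit Types C D M U W : comodule K n d.
Local Notation B := ('I_n * 'I_d)%type.

Lemma coprodE (b x y : B) : coprod K b (x, y) =
  [&& b.1 == y.1, b.2 == (x.2 + y.2)%N :> nat & x.1 == ((y.1 + y.2) %% n)%N :> nat]%:R.
Proof.
rewrite /coprod sum_ffunE.
have bn : (b.1 %% n = b.1)%N by rewrite modn_small.
under eq_bigr => m _ do rewrite !ffunE /= bn -natrM mulnb.
have [le_yb|lt_by] := leqP y.2 b.2; last first.
  rewrite big1 => [|[m lt_m] _] /=; last first.
    by rewrite (_ : (y.2 == m :> nat) = false) ?andbF //; apply/eqP; lia.
  by rewrite (_ : (_ == (_ + _)%N) = false) ?andbF //; apply/eqP; lia.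
rewrite -ltnS in le_yb; rewrite (bigD1 (Ordinal le_yb)) //= big1 ?addr0; last first.
  move=> [m lt_m]; rewrite -val_eqE /= => ne; rewrite [y.2 == _ :> nat]eq_sym (negbTE ne).
  by rewrite !andbF.
have -> : (x.2 == (b.2 - y.2)%N :> nat) = (b.2 == (x.2 + y.2)%N :> nat).
  by apply/eqP/eqP; lia.
rewrite eqxx andbT -[b.1 == _]val_eqE /= [y.1 == _ :> nat]eq_sym.
have [->|_] := eqVneq (b.1 : nat) y.1; last by rewrite andbF.
by rewrite andbT andbC.
Qed.

(** The action of the linear form equal to 1 on every arrow and 0 on the other paths. It is zero
    when [d <= 1], where there are no arrows. *)
Definition shift C (v : C) : C := \sum_(b : B | b.2 == 1%N :> nat) coact C v b.

Lemma shift_is_linear C : linear (@shift C).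
Proof.
move=> a u v; rewrite /shift scaler_sumr -big_split; apply: eq_bigr => b _.
by rewrite linearP !ffunE.
Qed.

HB.instance Definition _ C := GRing.isLinear.Build K C C _ (@shift C) (@shift_is_linear C).

(* A comodule is the same thing as a [Z/n]-graded space with an operator [shift] of
   degree 1 whose [d]-th power vanishes; [homog i u] says that [u] has degree [i]. *)
Definition homog C (i : nat) (u : C) : Prop :=
  forall b : B, coact C u b = (b.1 == (i %% n)%N :> nat)%:R *: iter b.2 (@shift C) u.

(** The inner sum has at most one term, the concatenated path; it is empty when the total length
    reaches [d]. *)
Lemma coact_coact C (u : C) (x y : B) : coact C (coact C u y) x =
  (x.1 == ((y.1 + y.2) %% n)%N :> nat)%:R *:
    \sum_(b : B | (b.1 == y.1) && (b.2 == (x.2 + y.2)%N :> nat)) coact C u b.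
Proof.
rewrite coactA scaler_sumr [RHS]big_mkcond; apply: eq_bigr => b _.
rewrite coprodE; case: eqP => _ /=; last by rewrite scale0r.
by case: eqP => _ /=; rewrite ?scale0r.
Qed.

(** Components at paths of length 0 suffice: by the counit axiom [u] is its own component at the
    vertex [i], and coassociativity then gives the components of greater length by iterating
    [shift]. *)
Lemma homogP C (i : nat) (u : C) :
  (forall b : B, b.2 = 0%N :> nat -> b.1 != (i %% n)%N :> nat -> coact C u b = 0) ->
  homog i u.
Proof.
move=> u0 b.
have [d0 n0] : (0 < d)%N /\ (0 < n)%N.
  by split; [exact: leq_trans (ltn_ord b.2)|exact: leq_trans (ltn_ord b.1)].
have lt_in : (i %% n < n)%N by rewrite ltn_mod.
pose c l (lt_l : (l < d)%N) : B := (Ordinal lt_in, Ordinal lt_l).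
have uE : coact C u (c 0%N d0) = u.
  rewrite -[RHS]coact1 (bigD1 (c 0%N d0)) //= /counit eqxx scale1r big1 ?addr0 // => -[x1 x2].
  rewrite xpair_eqE -!val_eqE /= negb_and.
  case: (boolP (x2 == 0%N :> nat)) => [/eqP x0|]; last by rewrite scale0r.
  by rewrite orbF => ne; rewrite u0 ?scaler0.
have [b1|b1] := eqVneq (b.1 : nat) (i %% n)%N; last first.
  rewrite -uE coact_coact /= addn0 modn_mod (negbTE b1) scale0r.
  by rewrite scale0r.
rewrite scale1r.
have -> : b = c b.2 (ltn_ord b.2).
  by rewrite [b]surjective_pairing; congr (_, _); apply: val_inj.
move: (ltn_ord b.2); move: (val b.2) => l; elim: l => [|l IH] lt_l.
  by rewrite (bool_irrelevance lt_l d0).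
rewrite /= -(IH (ltnW lt_l)) /shift.
have d1 : (1 < d)%N by lia.
have lt_j : ((i %% n + l) %% n < n)%N by rewrite ltn_mod.
pose x : B := (Ordinal lt_j, Ordinal d1).
rewrite (bigD1 x) //= big1 ?addr0 => [|[z1 z2] /andP[/eqP /= z2E]]; last first.
  rewrite coact_coact /= xpair_eqE -!val_eqE /= z2E andbT => /negbTE->.
  by rewrite scale0r.
rewrite coact_coact /= eqxx scale1r (big_pred1 (c l.+1 lt_l)) //.
Qed.

Lemma homog_shift C i (u : C) : homog i u -> homog i.+1 (shift u).
Proof.
move=> hu; apply: homogP => b b2 b1; rewrite linear_sum sum_ffunE big1 // => c /eqP c2.
rewrite hu c2 linearZ ffunE /=.
have [c1|_] := eqVneq (c.1 : nat) (i %% n)%N; last by rewrite scale0r.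
have -> : shift u = coact C u c by rewrite hu c1 eqxx scale1r c2.
rewrite coact_coact c1 c2 modnDml addn1 (negbTE b1) scale0r.
by rewrite scaler0.
Qed.

Lemma homog_iter C i m (u : C) : homog i u -> homog (i + m) (iter m (@shift C) u).
Proof.
by move=> hu; elim: m => [|m IH]; rewrite ?addn0 // addnS iterS; apply: homog_shift.
Qed.

Lemma homogD C i (u v : C) : homog i u -> homog i v -> homog i (u + v).
Proof.
move=> hu hv; apply: homogP => b b2 b1.
by rewrite linearD ffunE hu hv (negbTE b1) !scale0r addr0.
Qed.

Lemma homogZ C i a (u : C) : homog i u -> homog i (a *: u).
Proof.
move=> hu; apply: homogP => b b2 b1.
by rewrite linearZ ffunE /= hu (negbTE b1) scale0r scaler0.
Qed.

Lemma homog0 C i : homog i (0 : C).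
Proof. by apply: homogP => b b2 b1; rewrite linear0 ffunE. Qed.

(** The (d-1)-st iterate is a component of the coaction at a path of length [d - 1]; one more shift
    would need a path of length [d]. *)
Lemma iter_shift_order C i (u : C) : (0 < n)%N -> homog i u -> iter d (@shift C) u = 0.
Proof.
(* For [d = 0] there are no paths at all, and the counit axiom makes every vector zero. *)
move=> n_gt0 hu; have [d0|d_gt0] := posnP d.
  rewrite -[iter _ _ _]coact1 big1 // => b; have := ltn_ord b.2.
  by rewrite [X in (_ < X)%N]d0.
have lt_in : (i %% n < n)%N by rewrite ltn_mod.
have lt_d : (d.-1 < d)%N by rewrite prednK.
pose b : B := (Ordinal lt_in, Ordinal lt_d).
have b2d : b.2.+1 = d by exact: prednK.
suff: iter b.2.+1 (@shift C) u = 0 by rewrite b2d.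
rewrite iterS; have -> : iter b.2 (@shift C) u = coact C u b by rewrite hu eqxx scale1r.
rewrite /shift big1 // => c /eqP c2; rewrite coact_coact c2 add1n b2d.
rewrite big_pred0 ?scaler0 // => x; rewrite andbC.
by have /ltn_eqF-> := ltn_ord x.2.
Qed.

Definition comodule_morph C D (phi : {linear C -> D}) : Prop :=
  forall (u : C) b, coact D (phi u) b = phi (coact C u b).

(** Only chosen generators are required to lie in the image, so that covers by summands can be
    concatenated; surjectivity comes later, in [covers_iso]. *)
Definition covers C M (us : seq C) : Prop :=
  exists2 phi : {linear M -> C}, comodule_morph phi & forall u, u \in us -> exists v, u = phi v.

Lemma covers_zero C : covers (zero_comodule K n d) ([::] : seq C).
Proof.
exists (\0 : {linear 'rV[K]_0 -> C}) => // u b.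
by rewrite /= linear0 ffunE.
Qed.

Lemma covers_dsum C M (M' : comodule K n d) (us us' : seq C) :
  covers M us -> covers M' us' -> covers (M \oplus M') (us ++ us').
Proof.
case=> phi phiP us_phi [psi psiP us_psi].
pose chi (v : M \oplus M') : C := phi v.1 + psi v.2.
have chi_lin : linear chi.
  by move=> a u v; rewrite /chi !linearP /= scalerDr addrACA.
pose Chi : {linear (M \oplus M') -> C} := HB.pack chi (GRing.isLinear.Build _ _ _ _ _ chi_lin).
exists Chi => [v b|u].
  by rewrite /= /chi linearD ffunE phiP psiP ffunE.
rewrite mem_cat => /orP[/us_phi|/us_psi] [v ->].
  by exists (v, 0); rewrite /= /chi /= linear0 addr0.
by exists (0, v); rewrite /= /chi /= linear0 add0r.
Qed.

(** The predicate [Q] keeps track of the form of the generator chosen for each summand, which the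
    spanning argument needs afterwards. *)
Lemma covers_bigoplus C (I : eqType) (r : seq I) (M : I -> comodule K n d)
    (Q : I -> C -> Prop) :
    (forall i, i \in r -> exists2 u, Q i u & covers (M i) [:: u]) ->
  exists2 us : seq C, covers (\big[@dsum K n d/zero_comodule K n d]_(i <- r) M i) us &
    forall i, i \in r -> exists2 u, Q i u & u \in us.
Proof.
elim: r => [|i r IH] Mu; first by exists [::]; rewrite ?big_nil //; exact: covers_zero.
have [|us covs us_r] := IH; first by move=> j jr; apply: Mu; rewrite inE jr orbT.
have [u Qu covu] := Mu i (mem_head i r).
exists (u :: us) => [|j]; first by rewrite big_cons -cat1s; apply: covers_dsum.
rewrite inE => /predU1P[->|/us_r[v Qv v_us]]; first by exists u; rewrite ?mem_head.
by exists v; rewrite // inE v_us orbT.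
Qed.

Lemma dim_bigoplus (I : Type) (r : seq I) (M : I -> comodule K n d) :
  dim (\big[@dsum K n d/zero_comodule K n d]_(i <- r) M i) = (\sum_(i <- r) dim (M i))%N.
Proof.
elim: r => [|i r IH]; first by rewrite !big_nil.
by rewrite !big_cons /= -IH.
Qed.

Lemma morph_shift C D (phi : {linear C -> D}) : comodule_morph phi ->
  forall u, phi (shift u) = shift (phi u).
Proof.
by move=> phiP u; rewrite /shift linear_sum; apply: eq_bigr => b _; rewrite phiP.
Qed.

(** The image of the covering morphism is stable under [shift] and contains the generators, so it is
    everything; equality of dimensions then gives injectivity. *)
Lemma covers_iso C M (us : seq C) : covers M us -> dim M = dim C ->
    (forall S : {vspace C}, (forall v, v \in S -> shift v \in S) ->
       {subset us <= S} -> S = fullv) ->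
  comodule_iso C M.
Proof.
case=> phi phiP us_phi dimM gen.
pose f := linfun phi.
have fE v : f v = phi v by rewrite lfunE.
have f_onto : limg f = fullv.
  apply: gen => [v /memv_imgP[w _ ->]|u /us_phi[v ->]].
    by rewrite fE -morph_shift // -fE memv_img ?memvf.
  by rewrite -fE memv_img ?memvf.
have f_inj : lker f == 0%VS.
  rewrite -dimv_eq0; have := limg_ker_dim f fullv.
  by rewrite f_onto capfv !dimvf dimM; lia.
have fK : cancel f (f^-1)%VF by apply: lker0_lfunK.
have fVK : cancel (f^-1)%VF f.
  by move=> v; rewrite limg_lfunVK // f_onto memvf.
exists (f^-1)%VF; split; first by exists f.
move=> u b; apply: (can_inj fK); rewrite fVK fE -phiP -fE fVK //.
Qed.

End Comodules.

(** * The indecomposables as Jordan blocks *)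

Section Indecomposable.
Variables (K : fieldType) (n s d : nat) (zeta q : K).
Hypothesis H : admissible n s d zeta q.
Local Notation B := ('I_n * 'I_d)%type.

Lemma dim_indec i e : (e < d)%N -> dim (indec H i e) = e.+1.
Proof. by move=> lt_ed; rewrite /indec insubT; apply: etrans (mul1n _); exact: dim_matrix. Qed.

Lemma indec_coact_basis i (e : 'I_d) (m : 'I_e.+1) (b : B) :
  indec_coact n i (delta_mx 0 m) b =
  \sum_(x < e.+1 | (m <= x)%N) qpath K n d (i + m) (x - m) b *: (delta_mx 0 x : 'rV_e.+1).
Proof.
rewrite /indec_coact (bigD1 m) //= mxE !eqxx scale1r [X in _ + X]big1 => [|m' ne].
  by rewrite addr0 sum_ffunE; apply: eq_bigr => x _; rewrite ffunE.
by rewrite mxE (negbTE ne) andbF scale0r.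
Qed.

Lemma qpath_sum (V : lmodType K) e i m (b : B) (G : nat -> V) : (m <= e)%N ->
  \sum_(x < e.+1 | (m <= x)%N) qpath K n d i (x - m) b *: G x =
  (b.1 == (i %% n)%N :> nat)%:R *: (if (m + b.2 <= e)%N then G (m + b.2)%N else 0).
Proof.
move=> le_me; have [b1|b1] := eqVneq (b.1 : nat) (i %% n)%N; last first.
  by rewrite scale0r big1 // => x _; rewrite ffunE (negbTE b1) scale0r.
rewrite scale1r; case: ifP => [le_mb|gt_mb].
  rewrite -ltnS in le_mb; rewrite (bigD1 (Ordinal le_mb)) ?leq_addr //= ffunE b1 eqxx.
  rewrite addKn eqxx scale1r big1 ?addr0 // => -[x lt_x] /= /andP[le_mx].
  rewrite -val_eqE ffunE /= => ne; rewrite (_ : (b.2 == _ :> nat) = false) ?andbF ?scale0r //.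
  by apply/eqP; lia.
rewrite big1 // => -[x lt_x] /= le_mx; rewrite ffunE.
rewrite (_ : (b.2 == _ :> nat) = false) ?andbF ?scale0r //.
by apply/eqP; lia.
Qed.

(** Universal property of a Jordan block: sending v_m to the m-th shift of [u] respects the
    coaction, the only obstruction being that v_(e+1) = 0. *)
Lemma covers_indec_ord (C : comodule K n d) i (e : 'I_d) (u : C) :
  homog i u -> iter e.+1 (@shift K n d C) u = 0 -> covers (indec_ord H i e) [:: u].
Proof.
move=> hu u0.
have uge m : (e < m)%N -> iter m (@shift K n d C) u = 0.
  move=> lt_em; rewrite -(subnK lt_em) iterD u0.
  by elim: (m - _)%N => //= l ->; rewrite linear0.
pose phi (v : 'rV[K]_e.+1) : C := \sum_(m < e.+1) v 0 m *: iter m (@shift K n d C) u.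
have phi_lin : linear phi.
  move=> a v w; rewrite /phi scaler_sumr -big_split; apply: eq_bigr => m _.
  by rewrite !mxE scalerDl scalerA.
pose Phi : {linear 'rV[K]_e.+1 -> C} := HB.pack phi (GRing.isLinear.Build _ _ _ _ _ phi_lin).
have Phi_delta m : Phi (delta_mx 0 m) = iter m (@shift K n d C) u.
  rewrite [LHS]/(phi _) /phi (bigD1 m) //= mxE !eqxx scale1r big1 ?addr0 // => x ne.
  by rewrite mxE (negbTE ne) andbF scale0r.
exists Phi => [v b|w]; last first.
  by rewrite inE => /eqP->; exists (delta_mx 0 ord0); rewrite Phi_delta.
have basis m : coact C (Phi (delta_mx 0 m)) b =
    Phi (coact (indec_ord H i e) (delta_mx 0 m) b).
  rewrite [coact _ _ in RHS]/(indec_coact n i (delta_mx 0 m)) indec_coact_basis.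
  rewrite Phi_delta (homog_iter m hu) [RHS]linear_sum.
  under [RHS]eq_bigr => x _ do rewrite linearZ Phi_delta.
  rewrite (qpath_sum _ _ (fun x => iter x (@shift K n d C) u)); last by rewrite -ltnS.
  by rewrite -iterD [(b.2 + m)%N]addnC; case: leqP => // /uge->.
rewrite (row_sum_delta v) [Phi _]linear_sum !(linear_sum (coact _)) !sum_ffunE.
rewrite [RHS]linear_sum; apply: eq_bigr => m _.
by rewrite !linearZ !ffunE linearZ basis.
Qed.

Lemma covers_indec (C : comodule K n d) i e (u : C) :
  (e < d)%N -> homog i u -> iter e.+1 (@shift K n d C) u = 0 -> covers (indec H i e) [:: u].
Proof. by move=> lt_ed hu u0; rewrite /indec insubT; apply: covers_indec_ord. Qed.

Lemma homog_indec_basis i (e : 'I_d) (m : 'I_e.+1) :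
  homog (i + m) (delta_mx 0 m : indec_ord H i e).
Proof.
apply: homogP => b _ b1; rewrite [LHS]indec_coact_basis.
by rewrite big1 // => x _; rewrite ffunE (negbTE b1) scale0r.
Qed.

(** The generator is v_0, since [shift] sends v_m to v_(m+1) and v_e to 0. *)
Lemma indec_generator i e : (e < d)%N ->
  exists v : indec H i e, [/\ homog i v, iter e.+1 (@shift K n d _) v = 0 &
    forall w : indec H i e, exists c : 'I_e.+1 -> K,
      w = \sum_(m < e.+1) c m *: iter m (@shift K n d _) v].
Proof.
move=> lt_ed; rewrite /indec insubT; set e' : 'I_d := Sub e lt_ed.
(* Through [inord] the basis is indexed by natural numbers; [v m] is meant only for [m <= e]. *)
pose C := indec_ord H i e'; pose v m : C := delta_mx 0 (inord m : 'I_e'.+1).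
have hv m : (m <= e)%N -> homog (i + m) (v m).
  move=> le_me; have := @homog_indec_basis i e' (inord m); rewrite inordK //.
have shift_v m : (m <= e)%N -> shift (v m) = if (m < e)%N then v m.+1 else 0.
  move=> le_me; rewrite /shift.
  transitivity (\sum_(b : B | b.2 == 1%N :> nat) (b.1 == ((i + m) %% n)%N :> nat)%:R *:
      (if (m.+1 <= e)%N then v m.+1 else 0)).
    apply: eq_bigr => b /eqP b2; rewrite [LHS]indec_coact_basis inordK //.
    transitivity (\sum_(x < e.+1 | (m <= x)%N) qpath K n d (i + m) (x - m) b *: v x).
      by apply: eq_bigr => x _; rewrite /v inord_val.
    by rewrite qpath_sum // b2 addn1.
  case: ltnP => [lt_me|_]; last by rewrite big1 // => b _; rewrite scaler0.
  have d1 : (1 < d)%N by lia.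
  have lt_n : ((i + m) %% n < n)%N by rewrite ltn_mod ltnW ?(adm_n H).
  rewrite (bigD1 (Ordinal lt_n, Ordinal d1)) //= eqxx scale1r big1 ?addr0 // => -[x1 x2] /=.
  rewrite xpair_eqE -!val_eqE /= => /andP[/eqP->]; rewrite andbT => /negbTE->.
  by rewrite scale0r.
have iter_v m : (m <= e)%N -> iter m (@shift K n d C) (v 0%N) = v m.
  by elim: m => //= m IH lt_me; rewrite IH ?shift_v ?lt_me // ltnW.
exists (v 0%N); split.
- by rewrite -[i in homog i]addn0; apply: hv.
- by rewrite iterS iter_v // shift_v // ltnn.
move=> w; exists (fun m => w 0 m); rewrite {1}(row_sum_delta w); apply: eq_bigr => m _.
by rewrite iter_v ?/v ?inord_val // -ltnS.
Qed.

End Indecomposable.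

(** * The shift operator on a tensor product *)

Section TensorShift.
Variables (K : fieldType) (n s d : nat) (zeta q : K).
Hypothesis H : admissible n s d zeta q.
Variables U W : comodule K n d.
Local Notation B := ('I_n * 'I_d)%type.
Local Notation hbar := (zeta ^- s * q^-1).

Lemma tens0l (w : W) : tens (0 : U) w = 0.
Proof. by rewrite -[0 in LHS](scale0r (0 : U)) tensZl scale0r. Qed.

Lemma tens0r (u : U) : tens u (0 : W) = 0.
Proof. by rewrite -[0 in LHS](scale0r (0 : W)) tensZr scale0r. Qed.

Lemma sum_homog (V : lmodType K) (C : comodule K n d) i (u : C) (G : B -> C -> V) :
    homog i u -> (forall b, G b 0 = 0) ->
  \sum_b G b (coact C u b) =
  \sum_(b : B | b.1 == (i %% n)%N :> nat) G b (iter b.2 (@shift K n d C) u).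
Proof.
move=> hu G0; rewrite [RHS]big_mkcond; apply: eq_bigr => b _; rewrite hu.
by case: eqP; rewrite ?scale1r ?scale0r.
Qed.

Lemma homog_tens i j (u : U) (w : W) : homog i u -> homog j w ->
  homog (i + j) (tens u w : tensor H U W).
Proof.
move=> hu hw; apply: homogP => b b2 b1.
rewrite [LHS]tensor_coactE big1 // => c1 _; rewrite big1 // => c2 _; rewrite hu hw.
have [c1i|_] := eqVneq (c1.1 : nat) (i %% n)%N; last by rewrite scale0r tens0l scaler0.
have [c2j|_] := eqVneq (c2.1 : nat) (j %% n)%N; last by rewrite scale0r tens0r scaler0.
by rewrite !ffunE c1i c2j modnDm (negbTE b1) mulr0 scale0r.
Qed.

Lemma sum_fiber (V : lmodType K) i (G : nat -> nat -> V) : (0 < n)%N ->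
  \sum_(b : B | b.1 == (i %% n)%N :> nat) G b.1 b.2 = \sum_(l < d) G (i %% n)%N l.
Proof.
move=> n_gt0; have lt_n : (i %% n < n)%N by rewrite ltn_mod.
rewrite (eq_bigl (fun b : B => (b.1 == Ordinal lt_n) && predT b.2)); last first.
  by move=> b; rewrite andbT.
rewrite -(pair_big (fun b1 => b1 == Ordinal lt_n) predT
  (fun (b1 : 'I_n) (b2 : 'I_d) => G b1 b2)) /=.
by rewrite big_pred1_eq.
Qed.

(** A twisted Leibniz rule: a product of two paths has length 1 only for lengths (1, 0) and (0, 1),
    and the scalars are the structure constants of these two products. *)
Lemma shift_tens i j (u : U) (w : W) : homog i u -> homog j w ->
  shift (tens u w : tensor H U W) =
    hbar ^+ (j %% n) *: tens (shift u) w
    + (zeta ^+ s) ^+ ((i %% n) * ((1 + j %% n) %/ n)) *: tens u (shift w).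
Proof.
move=> hu hw; have n_gt0 : (0 < n)%N by exact: ltnW (adm_n H).
have d_gt0 : (0 < d)%N by exact: prim_order_gt0 (adm_d H).
pose A l m := mcoef n s zeta q (i %% n) l (j %% n) m.
(* The product of two basis paths has a single possible target, so summing over the arrows leaves
   its coefficient; the factor for [1 < d] records whether arrows exist. *)
have coefP (c1 c2 : B) : \sum_(b : B | b.2 == 1%N :> nat) mulM s zeta q c1 c2 b =
    ((c1.2 + c2.2 == 1)%N && (1 < d)%N)%:R * mcoef n s zeta q c1.1 c1.2 c2.1 c2.2.
  under eq_bigr => b _ do rewrite ffunE.
  rewrite -mulr_sumr mulrC; congr (_ * _).
  under eq_bigr => b b2 do rewrite ffunE (eqP b2) [1%N == _]eq_sym.
  have [d1|d1] := ltnP 1 d; last first.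
    by rewrite andbF big_pred0 // => b; apply/eqP => b2; have := ltn_ord b.2; rewrite b2 ltnNge d1.
  have lt_n : ((c1.1 + c2.1) %% n < n)%N by rewrite ltn_mod.
  rewrite (bigD1 (Ordinal lt_n, Ordinal d1)) //= eqxx andbT /= big1 ?addr0 // => -[x1 x2] /=.
  by rewrite xpair_eqE -!val_eqE /= => /andP[/eqP->]; rewrite andbT => /negbTE->.
transitivity (\sum_(l < d) \sum_(m < d) (((l + m == 1)%N && (1 < d)%N)%:R * A l m) *:
    tens (iter l (@shift K n d U) u) (iter m (@shift K n d W) w)).
  rewrite {1}/shift.
  under eq_bigr => b _ do rewrite [coact _ _ _]tensor_coactE.
  rewrite exchange_big /=.
  under eq_bigr => c1 _.
    rewrite exchange_big /=.
    under eq_bigr => c2 _ do rewrite -scaler_suml coefP.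
    over.
  pose G c1 c2 x y : tensor_space U W := (((c1.2 + c2.2 == 1)%N && (1 < d)%N)%:R *
    mcoef n s zeta q c1.1 c1.2 c2.1 c2.2) *: tens x y.
  rewrite (sum_homog (G := fun (c1 : B) x => \sum_(c2 : B) G (c1.1 : nat, c1.2 : nat)
     (c2.1 : nat, c2.2 : nat) x (coact W w c2)) hu); last first.
    by move=> c1; rewrite big1 // => c2 _; rewrite /G tens0l scaler0.
  rewrite (sum_fiber _ (fun c11 c12 => \sum_(c2 : B) G (c11, c12)
     (c2.1 : nat, c2.2 : nat) (iter c12 (@shift K n d U) u) (coact W w c2))) //.
  apply: eq_bigr => l _.
  rewrite (sum_homog (G := fun (c2 : B) y => G ((i %% n)%N, l : nat)
     (c2.1 : nat, c2.2 : nat) (iter l (@shift K n d U) u) y) hw); last first.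
    by move=> c2; rewrite /G tens0r scaler0.
  by rewrite (sum_fiber _ (fun c21 c22 => G ((i %% n)%N, l : nat)
     (c21, c22) (iter l (@shift K n d U) u) (iter c22 (@shift K n d W) w))).
have [d1|d1] := ltnP 1 d; last first.
  have u0 : shift u = 0.
    by rewrite /shift big_pred0 // => b; apply/eqP => b2; have := ltn_ord b.2; rewrite b2 ltnNge d1.
  have w0 : shift w = 0.
    by rewrite /shift big_pred0 // => b; apply/eqP => b2; have := ltn_ord b.2; rewrite b2 ltnNge d1.
  rewrite u0 w0 tens0l tens0r !scaler0 addr0 big1 // => l _; rewrite big1 // => m _.
  by rewrite andbF mul0r scale0r.
have A10 : A 1%N 0%N = hbar ^+ (j %% n).
  rewrite /A /mcoef gaussE addn0 add0n modn_mod subnn muln0 div0n expr0 mulr1.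
  by rewrite qbinnn !mulr1 !muln1 exprMn !exprVn exprM.
have A01 : A 0%N 1%N = (zeta ^+ s) ^+ ((i %% n) * ((1 + j %% n) %/ n)).
  rewrite /A /mcoef gaussE !muln0 !expr0 mod0n addn0 qbinN0 !invr1 mul1r mulr1 mul1r.
  rewrite -exprM; congr (_ ^+ _).
  by rewrite {1}(divn_eq (1 + j %% n) n) addnK !mulnA mulnK.
rewrite (bigD1 (Ordinal d1)) //= (bigD1 (Ordinal d_gt0)) //= mul1r A10.
rewrite big1 ?addr0; last first.
  by move=> [m lt_m]; rewrite -val_eqE /= => ne; rewrite (_ : (1 + m == 1)%N = false)
       ?mul0r ?scale0r //; lia.
congr (_ + _).
rewrite (bigD1 (Ordinal d_gt0)) //= (bigD1 (Ordinal d1)) //= mul1r A01.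
rewrite big1 ?addr0; last first.
  by move=> [m lt_m]; rewrite -val_eqE /= => ne; rewrite (_ : (0 + m == 1)%N = false)
       ?mul0r ?scale0r //; lia.
rewrite big1 ?addr0 // => -[l lt_l] /=; rewrite -!val_eqE /= => /andP[ne1 ne0].
rewrite big1 // => -[m lt_m] _ /=; rewrite (_ : (l + m == 1)%N = false) ?mul0r ?scale0r //.
by lia.
Qed.

End TensorShift.

(** * Decomposition of a quantum plane module into blocks *)

(** The dimension count, used with [M = e + f]: [p = e + 1] gives (e+1)(f+1), and [p = gamma + 1]
    gives (gamma+1)d, so full blocks have the same total dimension as the ones they replace. *)
Lemma sum_odd_descent M p : (2 * p <= M.+2)%N ->
  (\sum_(0 <= k < p) (M - 2 * k).+1 = p * (M.+2 - p))%N.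
Proof.
elim: p => [|p IH] le_p; first by rewrite big_nil.
by rewrite big_nat_recr //= IH; lia.
Qed.

Section Decomposition.
Variables (K : fieldType) (n s d : nat) (zeta q : K).
Hypothesis H : admissible n s d zeta q.

Section Blocks.
Variables (C : comodule K n d) (r : nat) (h : K) (e f : nat) (y : nat -> nat -> C).
Hypothesis ord_h : forall l, (d %| l)%N = (h ^+ l == 1).
Hypotheses (le_ef : (e <= f)%N) (lt_fd : (f < d)%N).
Hypothesis homog_y : forall a b, homog (r + a + b) (y a b).
Hypothesis shift_y : forall a b, shift (y a b) = h ^+ b *: y a.+1 b + y a b.+1.
Hypothesis y_gtl : forall a b, (e < a)%N -> y a b = 0.
Hypothesis y_gtr : forall a b, (f < b)%N -> y a b = 0.
Hypothesis span_y : forall S : {vspace C}, (forall a b, y a b \in S) -> S = fullv.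
Hypothesis dim_C : dim C = (e.+1 * f.+1)%N.

Local Notation hgen := (homogenize (@shift K n d C) y).

Let n_gt0 : (0 < n)%N. Proof. exact: ltnW (adm_n H). Qed.
Let d_gt0 : (0 < d)%N. Proof. exact: leq_ltn_trans lt_fd. Qed.

Lemma homog_homogenize k (g : {poly K}) : homog (r + k) (hgen k g).
Proof.
rewrite /homogenize; elim/big_ind: _ => [|u v|[a lt_a] _ /=].
- exact: homog0.
- exact: homogD.
apply: homogZ; have := homog_iter (k - a) (homog_y a 0).
by rewrite (_ : r + a + 0 + (k - a) = r + k)%N //; lia.
Qed.

(** The exact size of [g] says that the generator really contains Z^k, as [generators_span]
    requires. *)
Let Q k (u : C) := exists2 g : {poly K}, size g = k.+1 & u = hgen k g.

Lemma primitive_block k : (k <= e)%N -> (e + f - 2 * k < d)%N ->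
    (k == 0)%N || (e + f < d + k - 1)%N ->
  exists2 u, Q k u & covers (indec H (r + k) (e + f - 2 * k)) [:: u].
Proof.
move=> le_ke lt_d hk.
have [g sg g0] := primitive_generator shift_y y_gtl y_gtr ord_h d_gt0 le_ef le_ke hk.
exists (hgen k g); first by exists g.
by apply: covers_indec => //; apply: homog_homogenize.
Qed.

Lemma full_block k : exists2 u, Q k u & covers (indec H (r + k) (d - 1)) [:: u].
Proof.
exists (hgen k 'X^k); first by exists 'X^k; rewrite ?size_polyXn.
have hk := homog_homogenize k 'X^k.
apply: covers_indec => //; first by lia.
by rewrite subn1 prednK //; apply: iter_shift_order hk.
Qed.

Lemma blocks_iso M (us : seq C) : covers M us -> dim M = (e.+1 * f.+1)%N ->
  (forall k, (k <= e)%N -> exists2 u, Q k u & u \in us) -> comodule_iso C M.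
Proof.
move=> cov dimM us_gen; apply: (covers_iso cov); first by rewrite dimM dim_C.
move=> S shiftS usS; apply: span_y.
apply: (generators_span shift_y y_gtl shiftS) => k /us_gen[u [g sg ->] /usS gS].
by exists g.
Qed.

Lemma semisimple_blocks : (e + f < d)%N ->
  C \iso \bigoplus_(0 <= k < e.+1) indec H (r + k) (e + f - 2 * k).
Proof.
move=> lt_d.
have [|us cov us_gen] := covers_bigoplus (Q := Q) (r := index_iota 0 e.+1)
  (M := fun k => indec H (r + k) (e + f - 2 * k)).
  by move=> k; rewrite mem_index_iota => ke; apply: primitive_block; lia.
apply: blocks_iso cov _ _ => [|k ke]; last by apply: us_gen; rewrite mem_index_iota; lia.
rewrite dim_bigoplus (eq_bigr (fun k => (e + f - 2 * k).+1)) => [|k _].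
  by rewrite sum_odd_descent; lia.
by rewrite dim_indec; lia.
Qed.

Lemma nonsemisimple_blocks : (d <= e + f)%N -> let gamma := (e + f - d + 1)%N in
  C \iso (\bigoplus_(0 <= k < gamma.+1) indec H (r + k) (d - 1)
          \oplus \bigoplus_(gamma.+1 <= l < e.+1) indec H (r + l) (e + f - 2 * l)).
Proof.
move=> le_d gamma.
have [|us cov us_gen] := covers_bigoplus (Q := Q) (r := index_iota 0 gamma.+1)
  (M := fun k => indec H (r + k) (d - 1)).
  by move=> k _; apply: full_block.
have [|us' cov' us_gen'] := covers_bigoplus (Q := Q) (r := index_iota gamma.+1 e.+1)
  (M := fun k => indec H (r + k) (e + f - 2 * k)).
  (* The condition [gamma < k] is exactly [e + f < d + k - 1], the range of the Padé generators. *)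
  by move=> k; rewrite mem_index_iota /gamma => ke; apply: primitive_block; lia.
apply: blocks_iso (covers_dsum cov cov') _ _ => [|k ke]; last first.
  have [lt_k|le_k] := ltnP k gamma.+1.
    have [|u Qu u_us] := us_gen k; first by rewrite mem_index_iota.
    by exists u; rewrite // mem_cat u_us.
  have [|u Qu u_us] := us_gen' k; first by rewrite mem_index_iota le_k.
  by exists u; rewrite // mem_cat u_us orbT.
rewrite -[LHS]/(dim _ + dim _)%N !dim_bigoplus.
rewrite (eq_bigr (fun=> d)) => [|k _]; last by rewrite dim_indec ?subn1 ?prednK.
rewrite sum_nat_const_nat subn0.
rewrite (eq_big_nat _ _ (F2 := fun k => (e + f - 2 * k).+1)); last first.
  by move=> k ke; rewrite dim_indec //; rewrite /gamma in ke; lia.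
(* This bound comes from [f < d]; it allows the sum over [k <= e] to be cut after [gamma]. *)
have le_g : (gamma.+1 <= e.+1)%N by rewrite /gamma; lia.
have := @sum_odd_descent (e + f) e.+1; have := @sum_odd_descent (e + f) gamma.+1.
rewrite (big_cat_nat _ le_g) //= => -> //; last by rewrite /gamma; lia.
move=> /(_ ltac:(lia)); rewrite (_ : (e + f).+2 - gamma.+1 = d)%N; last by rewrite /gamma; lia.
rewrite (_ : (e + f).+2 - e.+1 = f.+1)%N; last by lia.
by rewrite mulnC => <-.
Qed.

End Blocks.

(** * Quantum plane bases of V(i,e) (x) V(j,f) *)

Section IndecTensor.
Variables (i j e f : nat).
Hypotheses (lt_ed : (e < d)%N) (lt_fd : (f < d)%N).
Local Notation hbar := (zeta ^- s * q^-1).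
Local Notation V := (tensor H (indec H i e) (indec H j f)).

Let n_gt0 : (0 < n)%N. Proof. exact: ltnW (adm_n H). Qed.

Let z_neq0 : zeta ^+ s != 0.
Proof.
rewrite expf_neq0 //; have := prim_expr_order (adm_zeta H).
by apply: contra_eqN => /eqP->; rewrite expr0n gtn_eqF // eq_sym oner_eq0.
Qed.

Let hbar_neq0 : hbar != 0.
Proof.
have := hbar_n H; apply: contra_eqN => /eqP->.
by rewrite expr0n gtn_eqF // eq_sym invr_eq0.
Qed.

(* The scalars absorb the reductions modulo [n] in the structure constants of
   M(n,s,q), leaving the relations of the quantum plane at [hbar]. *)
Lemma quantum_plane_basis : exists y : nat -> nat -> V, [/\
  forall a b, homog (i + j + a + b) (y a b),
  forall a b, shift (y a b) = hbar ^+ b *: y a.+1 b + y a b.+1,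
  forall a b, (e < a)%N -> y a b = 0,
  forall a b, (f < b)%N -> y a b = 0 &
  forall S : {vspace V}, (forall a b, y a b \in S) -> S = fullv].
Proof.
have [v [hv v0 v_span]] := indec_generator H i lt_ed.
have [w [hw w0 w_span]] := indec_generator H j lt_fd.
have z_n : (zeta ^+ s) ^+ n = 1.
  by rewrite exprAC (prim_expr_order (adm_zeta H)) expr1n.
pose va a := iter a (@shift K n d (indec H i e)) v.
pose wb b := iter b (@shift K n d (indec H j f)) w.
have iter0 (C : comodule K n d) m : iter m (@shift K n d C) 0 = 0.
  by elim: m => //= m ->; rewrite linear0.
have va0 a : (e < a)%N -> va a = 0 by move=> lt_a; rewrite /va -(subnK lt_a) iterD v0.
have wb0 b : (f < b)%N -> wb b = 0 by move=> lt_b; rewrite /wb -(subnK lt_b) iterD w0.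
(* These scalars solve the two recursions that [shift_tens] imposes: c(a,b) h^((j+b) mod n) = h^b
   c(a+1,b), and c(a,b+1) equals c(a,b) times the power of zeta^s produced by the carry modulo
   [n]. *)
pose c a b : K := hbar ^+ (j * a) * (zeta ^+ s) ^+ ((i + a) * ((j + b) %/ n)).
have c0 a b : c a b != 0 by rewrite mulf_neq0 // expf_neq0.
pose y a b : V := c a b *: tens (va a) (wb b).
exists y; split=> [a b|a b|a b lt_a|a b lt_b|S yS].
- apply: homogZ; rewrite (_ : i + j + a + b = (i + a) + (j + b))%N; last by lia.
  by apply: homog_tens; apply: homog_iter.
- rewrite linearZ /= (shift_tens H (homog_iter a hv) (homog_iter b hw)) scalerDr !scalerA.
  rewrite -!iterS -[iter a.+1 _ _]/(va a.+1) -[iter b.+1 _ _]/(wb b.+1).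
  rewrite /c; set m := ((j + b) %/ n)%N; set rho := ((j + b) %% n)%N.
  have jb : (j + b = m * n + rho)%N by exact: divn_eq.
  congr (_ *: _ + _ *: _).
    (* Because h^n = zeta^(-s), reducing [j + b] modulo [n] in the exponent of h costs a power of
       zeta^s. *)
    have hz : hbar ^+ (m * n) * (zeta ^+ s) ^+ m = 1.
      by rewrite mulnC exprM (hbar_n H) exprVn mulVf // expf_neq0.
    have -> : ((i + a.+1) * m = (i + a) * m + m)%N by lia.
    rewrite [in RHS]mulrA -exprD (_ : b + j * a.+1 = j * a + (m * n + rho))%N; last first.
      by rewrite mulnS -jb; lia.
    rewrite !exprD -[LHS]mulr1 -hz; ring.
  rewrite /c; have -> : ((j + b.+1) %/ n = m + (1 + rho) %/ n)%N.
    by rewrite addnS jb -addnS -add1n divnMDl.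
  rewrite mulnDr !exprD mulrA; congr (_ * _).
  by rewrite [LHS]exprM [RHS]exprM expr_mod.
- by rewrite /y va0 // tens0l scaler0.
- by rewrite /y wb0 // tens0r scaler0.
apply/eqP; rewrite eqEsubv subvf; apply/subvP => t _ /=.
have tensS a b : tens (va a) (wb b) \in S.
  by rewrite -[tens _ _](scalerK (c0 a b)) rpredZ // yS.
rewrite (tensor_spaceE t); apply: rpred_sum => x1 _; apply: rpred_sum => x2 _.
rewrite rpredZ //.
have [a ->] := v_span (vbasis fullv)`_x1; have [b ->] := w_span (vbasis fullv)`_x2.
rewrite tens_suml; apply: rpred_sum => m1 _; rewrite tens_sumr; apply: rpred_sum => m2 _.
by rewrite tensZl tensZr !rpredZ // tensS.
Qed.

(* Rescaling by powers of [hbar] exchanges the two factors and inverts [hbar]. *)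
Lemma quantum_plane_basis_swap : exists y : nat -> nat -> V, [/\
  forall a b, homog (i + j + a + b) (y a b),
  forall a b, shift (y a b) = hbar^-1 ^+ b *: y a.+1 b + y a b.+1,
  forall a b, (f < a)%N -> y a b = 0,
  forall a b, (e < b)%N -> y a b = 0 &
  forall S : {vspace V}, (forall a b, y a b \in S) -> S = fullv].
Proof.
have [y [hy shift_y y_gtl y_gtr span_y]] := quantum_plane_basis.
pose x a b := hbar ^+ (a * b) *: y b a.
have c0 a b : hbar ^+ (a * b) != 0 by rewrite expf_neq0 // hbar_neq0.
exists x; split=> [a b|a b|a b lt_a|a b lt_b|S xS].
- by apply: homogZ; rewrite addnAC.
- rewrite linearZ /= shift_y scalerDr !scalerA addrC -exprD -mulnSr.
  congr (_ *: _ + _); rewrite mulSn exprD mulrA exprVn mulVf ?mul1r //.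
  by rewrite expf_neq0 // hbar_neq0.
- by rewrite /x y_gtr ?scaler0.
- by rewrite /x y_gtl ?scaler0.
apply: span_y => a b; rewrite -[y a b](scalerK (c0 b a)) rpredZ //; exact: xS.
Qed.

Lemma dim_tensor_indec : dim V = (e.+1 * f.+1)%N.
Proof. by rewrite [LHS]dim_matrix !dimvf !dim_indec. Qed.

End IndecTensor.
End Decomposition.

Theorem theorem3p10 (K : closedFieldType) (n s d : nat) (zeta q : K)
    (charK : [pchar K] =i pred0) (n_gt1 : (1 < n)%N)
    (zeta_prim : n.-primitive_root zeta) (s_lt_n : (s < n)%N)
    (q_root : q ^+ n = zeta ^+ s) (q_order : d.-primitive_root q)
    (i j e f : nat) (i_lt_n : (i < n)%N) (j_lt_n : (j < n)%N)
    (e_lt_d : (e < d)%N) (f_lt_d : (f < d)%N) :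
  let H := Admissible n_gt1 zeta_prim s_lt_n q_root q_order in
  let V := tensor H (indec H i e) (indec H j f) in
  ((e + f <= d - 1)%N ->
     V \iso
       (if (e <= f)%N then
         \bigoplus_(0 <= k < e.+1) indec H (i + j + k) (e + f - 2 * k)
       else
         \bigoplus_(0 <= k < f.+1) indec H (i + j + k) (e + f - 2 * k)))
  /\
  ((d <= e + f)%N ->
     let gamma := (e + f - d + 1)%N in
     V \iso
       (if (e <= f)%N then
         \bigoplus_(0 <= k < gamma.+1) indec H (i + j + k) (d - 1)
         \oplus \bigoplus_(gamma.+1 <= l < e.+1)
               indec H (i + j + l) (e + f - 2 * l)
       else
         \bigoplus_(0 <= k < gamma.+1) indec H (i + j + k) (d - 1)
         \oplus \bigoplus_(gamma.+1 <= l < f.+1)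
               indec H (i + j + l) (e + f - 2 * l))).
Proof.
move=> H V; have d_gt0 : (0 < d)%N by exact: leq_ltn_trans e_lt_d.
have ord_h := hbar_order H; set hbar := _ * _ in ord_h.
(* Exchanging the factors replaces h by its inverse, which has the same order. *)
have ord_hV l : (d %| l)%N = (hbar^-1 ^+ l == 1) by rewrite exprVn invr_eq1 ord_h.
have dimV : dim V = (e.+1 * f.+1)%N := dim_tensor_indec H i j e_lt_d f_lt_d.
have dimV' : dim V = (f.+1 * e.+1)%N by rewrite mulnC.
have [y [hy shift_y y_gtl y_gtr span_y]] := quantum_plane_basis H i j e_lt_d f_lt_d.
have [x [hx shift_x x_gtl x_gtr span_x]] := quantum_plane_basis_swap H i j e_lt_d f_lt_d.
split=> le_ef.
  have lt_efd : (e + f < d)%N by lia.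
  case: leqP => [le_e|/ltnW le_f].
    exact: (semisimple_blocks H ord_h le_e f_lt_d hy shift_y y_gtl y_gtr span_y dimV).
  (* The block lengths depend only on the sum [e + f], so the same decomposition applies with the
     roles of [e] and [f] exchanged. *)
  rewrite [(e + f)%N]addnC in lt_efd *.
  exact: (semisimple_blocks H ord_hV le_f e_lt_d hx shift_x x_gtl x_gtr span_x dimV').
case: leqP => [le_e|/ltnW le_f].
  exact: (nonsemisimple_blocks H ord_h le_e f_lt_d hy shift_y y_gtl y_gtr span_y dimV).
rewrite [(e + f)%N]addnC in le_ef *.
exact: (nonsemisimple_blocks H ord_hV le_f e_lt_d hx shift_x x_gtl x_gtr span_x dimV').
Qed.
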